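(* Let $f=(f_0,\dots,f_7)$ be a non-negative (left) octonion-valued monogenic function in the upper half-space $\mathbb{R}^8_+$ (so $f_j\ge 0$ for $j=0,\dots,7$), let $l=(l_0,l_1,\dots,l_7)$ be a vector with components $l_j\in[0,+\infty]$, and let $X\in\mathbb{R}^7$. In order that the limit $$\lim_{x_0\to0^+} f(x_0,X)=l$$ exist at the boundary point $(0,X)$ (i.e. $f_j(x_0,X)\to l_j$ as $x_0\to 0^+$, for each $j$), it is necessary and sufficient that for every $j=0,1,\dots,7$ either $$\lim_{t\to0^+} t^{-7}\,n_j(t,X)=\omega_7\, l_j$$ if $l_j$ is finite, or $$\lim_{t\to0^+} t\int_t^a s^{-9}\,n_j(s,X)\,ds=+\infty$$ if $l_j=+\infty$ (for any, and therefore for every, $a>0$). Here $\omega_7$ is the volume of the unit ball in $\mathbb{R}^7$.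
   Context: Half-space: $\mathbb{R}^8_+=\{\mathbf{x}=(x_0,X): x_0>0,\ X=(x_1,\dots,x_7)\in\mathbb{R}^7\}$, with boundary identified with $\mathbb{R}^7$. Octonions: the real algebra with basis $\mathbf{e}_0=1,\mathbf{e}_1,\dots,\mathbf{e}_7$, where $\mathbf{e}_i^2=-1$ and $\mathbf{e}_i\mathbf{e}_j=-\mathbf{e}_j\mathbf{e}_i$ for distinct $i,j\ge 1$, and $\mathbf{e}_i\mathbf{e}_j=\mathbf{e}_k$ for $(i,j,k)$ equal to $(1,2,4),(1,3,7),(1,5,6),(2,3,5),(2,6,7),(3,4,6),(4,5,7)$ and their cyclic permutations. Monogenic functions: a function $f=\sum_{j=0}^7 f_j\mathbf{e}_j$ with real-valued continuously differentiable components on a simply connected domain $\Omega\subset\mathbb{R}^8$ is called (left) octonion-valued monogenic if $\sum_{k=0}^7\sum_{j=0}^7 \frac{\partial f_j}{\partial x_k}\,\mathbf{e}_k\mathbf{e}_j=0$ in $\Omega$; that is, writing $\partial_k=\partial/\partial x_k$, $$\begin{aligned} &\partial_0f_0-\partial_1f_1-\partial_2f_2-\partial_3f_3-\partial_4f_4-\partial_5f_5-\partial_6f_6-\partial_7f_7=0,\\ &\partial_1f_0+\partial_0f_1-\partial_4f_2-\partial_7f_3+\partial_2f_4-\partial_6f_5+\partial_5f_6+\partial_3f_7=0,\\ &\partial_2f_0+\partial_4f_1+\partial_0f_2-\partial_5f_3-\partial_1f_4+\partial_3f_5-\partial_7f_6+\partial_6f_7=0,\\ &\partial_3f_0+\partial_7f_1+\partial_5f_2+\partial_0f_3-\partial_6f_4-\partial_2f_5+\partial_4f_6-\partial_1f_7=0,\\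 &\partial_4f_0-\partial_2f_1+\partial_1f_2+\partial_6f_3+\partial_0f_4-\partial_7f_5-\partial_3f_6+\partial_5f_7=0,\\ &\partial_5f_0+\partial_6f_1-\partial_3f_2+\partial_2f_3+\partial_7f_4+\partial_0f_5-\partial_1f_6-\partial_4f_7=0,\\ &\partial_6f_0-\partial_5f_1+\partial_7f_2-\partial_4f_3+\partial_3f_4+\partial_1f_5+\partial_0f_6-\partial_2f_7=0,\\ &\partial_7f_0-\partial_3f_1-\partial_6f_2+\partial_1f_3-\partial_5f_4+\partial_4f_5+\partial_2f_6+\partial_0f_7=0. \end{aligned}$$ Each component $f_j$ of a monogenic function is harmonic. If $f_j\ge0$ in $\mathbb{R}^8_+$, then by the Riesz–Herglotz theorem it has a representation $$f_j(x_0,X)=c_jx_0+\int_{\mathbb{R}^7}P(x_0,X-Y)\,d\mu_j(Y),$$ where $c_j\ge0$, $P$ is the Poisson kernel of $\mathbb{R}^8_+$ (normalized so that $\int_{\mathbb{R}^7}P(x_0,Y)\,dY=1$ for all $x_0>0$), and $\mu_j$ is a non-negative Radon measure on $\mathbb{R}^7$, called the boundary measure of $f_j$. For $t>0$ and $X\in\mathbb{R}^7$, $n_j(t,X)=\int_{B(X,t)}d\mu_j(Y)$, where $B(X,t)\subset\mathbb{R}^7$ is the ball of radius $t$ centered at $X$. *)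

(* Defs.v *)
From HB Require Import structures.
From mathcomp Require Import all_boot all_order all_algebra.
From mathcomp Require Import all_classical all_reals all_analysis.
Set Implicit Arguments.
Unset Strict Implicit.
Unset Printing Implicit Defensive.
Import Order.TTheory GRing.Theory Num.Theory.
Import numFieldNormedType.Exports.

Local Open Scope classical_set_scope.
Local Open Scope ring_scope.

(** Octonions are represented by their coordinates in the basis
    e_0 = 1, e_1, ..., e_7, i.e. as elements of ['rV[R]_8]. *)

Definition oct_triples : seq (nat * nat * nat) :=
  [:: (1, 2, 4); (1, 3, 7); (1, 5, 6); (2, 3, 5); (2, 6, 7); (3, 4, 6);
      (4, 5, 7)]%N.

Definition oct_triple (i j k : nat) : bool :=
  [|| (i, j, k) \in oct_triples, (j, k, i) \in oct_triples
    | (k, i, j) \in oct_triples].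

(* The coefficient of e_k in the product e_i e_j. *)
Definition oct_coef (i j k : nat) : int :=
  if i == 0%N then (j == k)%:Z
  else if j == 0%N then (i == k)%:Z
  else if i == j then - (k == 0%N)%:Z
  else (oct_triple i j k)%:Z - (oct_triple j i k)%:Z.

Definition oct_basis_mul {R : realType} (i j : 'I_8) : 'rV[R]_8 :=
  \row_k (oct_coef i j k)%:~R.

(** Functions are total on R^8; only their values on [Omega], which is meant
    to be an open (simply connected) set, matter. *)

Definition component {R : realType} {T : Type} (f : T -> 'rV[R]_8) (j : 'I_8) :
  T -> R := fun x => f x 0 j.

Definition partial {R : realType} (k : 'I_8) (u : 'rV[R]_8 -> R) :
  'rV[R]_8 -> R := fun x => 'D_(delta_mx 0 k) u x.

Definition continuously_differentiable {R : realType} (Omega : set 'rV[R]_8)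
    (u : 'rV[R]_8 -> R) : Prop :=
  forall (k : 'I_8) (x : 'rV[R]_8), Omega x ->
    derivable u x (delta_mx 0 k) /\ {for x, continuous (partial k u)}.

Definition monogenic {R : realType} (Omega : set 'rV[R]_8)
    (f : 'rV[R]_8 -> 'rV[R]_8) : Prop :=
  (forall j : 'I_8, continuously_differentiable Omega (component f j)) /\
  (forall x : 'rV[R]_8, Omega x ->
    \sum_(k < 8) \sum_(j < 8)
      partial k (component f j) x *: oct_basis_mul k j = 0).

Definition half_space {R : realType} : set 'rV[R]_8 := [set x | 0 < x 0 0].

Definition hpoint {R : realType} (x0 : R) (X : 'rV[R]_7) : 'rV[R]_8 :=
  row_mx (x0%:M : 'rV[R]_1) X.

(* The library's norm on row vectors is the supremum norm. *)
Definition enorm {R : realType} {n : nat} (Y : 'rV[R]_n) : R :=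
  Num.sqrt (\sum_(i < n) Y 0 i ^+ 2).

Definition eball {R : realType} {n : nat} (X : 'rV[R]_n) (t : R) :
  set 'rV[R]_n := [set Y | enorm (Y - X) < t].

Definition borel7 (R : realType) := g_sigma_algebraType (@open 'rV[R]_7).

(** Lebesgue measure on R^7: the 7-fold product measure, transported to
    ['rV[R]_7]. *)

Definition row7 {R : realType} (y : R * R * R * R * R * R * R) : borel7 R :=
  let: (y1, y2, y3, y4, y5, y6, y7) := y in
  \row_(i < 7) nth 0 [:: y1; y2; y3; y4; y5; y6; y7] i.

Local Notation leb R := (@lebesgue_measure R).

Definition lebesgue7 (R : realType) : set (borel7 R) -> \bar R :=
  pushforward
    (leb R \x leb R \x leb R \x leb R \x leb R \x leb R \x leb R)%E row7.

Definition omega7 (R : realType) : R :=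
  fine (lebesgue7 (eball (0 : 'rV[R]_7) 1)).

(** The Poisson kernel of the half-space, with its constant fixed by the
    requirement that it has integral 1 over the boundary; by homogeneity it is
    enough to normalize at x_0 = 1. *)

Definition poisson_shape {R : realType} (x0 : R) (Y : 'rV[R]_7) : R :=
  x0 / (x0 ^+ 2 + enorm Y ^+ 2) ^+ 4.

Definition poisson {R : realType} (x0 : R) (Y : 'rV[R]_7) : R :=
  poisson_shape x0 Y /
  fine (\int[@lebesgue7 R]_(Z in setT) (poisson_shape 1 Z)%:E)%E.

(* On R^7 every Borel measure finite on compact sets is automatically
   regular. *)
Definition radon {R : realType} (mu : set (borel7 R) -> \bar R) : Prop :=
  forall K : set 'rV[R]_7, compact K -> (mu K < +oo)%E.

Definition boundary_measure {R : realType} (u : 'rV[R]_8 -> R)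
    (mu : {measure set (borel7 R) -> \bar R}) : Prop :=
  radon mu /\
  exists2 c : R, 0 <= c &
    forall (x0 : R) (X : 'rV[R]_7), 0 < x0 ->
      ((u (hpoint x0 X))%:E =
       (c * x0)%:E + \int[mu]_(Y in setT) (poisson x0 (X - (Y : 'rV[R]_7)))%:E)%E.

Definition ball_mass {R : realType} (mu : set (borel7 R) -> \bar R)
    (t : R) (X : 'rV[R]_7) : \bar R := mu (eball X t).

Definition finite_density {R : realType} (mu : set (borel7 R) -> \bar R)
    (X : 'rV[R]_7) (l : \bar R) : Prop :=
  (fun t : R => (t ^- 7)%:E * ball_mass mu t X)%E @ (0 : R)^'+
    --> ((omega7 R)%:E * l)%E.

Definition infinite_density {R : realType} (mu : set (borel7 R) -> \bar R)
    (X : 'rV[R]_7) (a : R) : Prop :=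
  (fun t : R => t%:E *
     \int[@lebesgue_measure R]_(s in `[t, a]) ((s ^- 9)%:E * ball_mass mu s X))%E
    @ (0 : R)^'+ --> (+oo)%E.

(* Main.v *)
Require Import Defs.
From HB Require Import structures.
From mathcomp Require Import all_boot all_order all_algebra.
From mathcomp Require Import all_classical all_reals all_analysis.
From mathcomp Require Import measurable_realfun.
From mathcomp Require Import ring lra.
Import Order.TTheory GRing.Theory Num.Theory.
Import numFieldNormedType.Exports.
Local Open Scope classical_set_scope.
Local Open Scope ring_scope.

(** Fix the boundary point [X] and one component, with boundary measure [mu].
    Only the distribution of the distance to [X] under [mu] matters: pushing
    [mu] forward along [Y |-> |Y - X|] gives a measure [m] on the half-line
    with [m [0, s[ = mu (B(X, s))], and the value of the component above [X]
    at height [x] is, up to the factor [K^-1] and the vanishing term [c x],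
    the number [x * \int (x^2 + r^2)^-4 dm(r)].  By [layer_cake] this is
    [x * \int_0^oo 8 s (x^2 + s^2)^-5 n(s) ds] with [n(s) = mu (B(X, s))].

    Infinite limits ([infinite_limit_density_int]).  The kernel
    [8 s (x^2 + s^2)^-5] is comparable to [s^-9] for [s >= x], the part beyond
    a fixed [a] contributes [O(x)], and the part below [x] is controlled
    by [x^-7 n(x)], hence, [n] being monotone, by the integral of
    [s^-9 n(s)] over [[x, 2 x]].  So the component and
    [x \int_x^a s^-9 n(s) ds] are infinite in the limit together, for each
    [a > 0] separately; this also gives the independence of [a].

    Finite limits.  No constant is computed: everything is compared with
    Lebesgue measure, for which [n(s) = omega_7 s^7] and the potential is the
    constant [K], both by homogeneity ([lebesgue7_scale]).  If
    [n(s) ~ l omega_7 s^7], integrating this comparison against the kernel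
    gives the limit [l K] ([abelian_comparison]).

    The converse is Tauberian and follows Karamata.  Let [w(r) = 1/(1 + r^2)]
    and consider the functions [phi] such that the averages
    [x^-7 \int phi(r / x) dm(r)] tend to [l] times the same average for
    Lebesgue measure.  The hypothesis says that [w^4] is one of them.  They
    form a vector space, stable under dilation, and closed under sandwiching
    ([avg_cvg_sandwich]).  Difference quotients of [w^k] along dilations
    approximate [w^(k + 1)], so all [w^k] with [k >= 4] belong to the space,
    and so do the polynomials in [w] divisible by [w^4].  The polynomials
    [1 - (1 - w^N)^(2^N)] are of this kind for [N >= 4], and they converge to
    the indicator of [w > 1/2], that is of [r < 1].  Hence the indicator of
    [[0, 1[] belongs to the space ([avg_cvg_step]), and its average is
    [x^-7 n(x)]. *)

Set Implicit Arguments.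
Unset Strict Implicit.

(** * The layer-cake formula for the Poisson kernel *)

Section layer.
Context {R : realType}.
Implicit Types (x r s : R).

(** Minus the radial derivative of [(x^2 + s^2)^-4], which is the Poisson kernel
    of the half-space up to the factor [x] and a constant. *)
Definition layer_kernel x s : R := 8 * s / (x ^+ 2 + s ^+ 2) ^+ 5.

Lemma sqrD_gt0 x s : 0 < x -> 0 < x ^+ 2 + s ^+ 2.
Proof. by move=> x0; rewrite ltr_wpDr ?sqr_ge0 ?exprn_gt0. Qed.

Lemma layer_kernel_ge0 x s : 0 <= s -> 0 <= layer_kernel x s.
Proof. by move=> s0; rewrite divr_ge0 ?mulr_ge0 ?exprn_ge0 ?addr_ge0 ?sqr_ge0. Qed.

Lemma is_derive_layer_kernel x s : 0 < x ->
  is_derive s 1 (fun s => - (x ^+ 2 + s ^+ 2) ^- 4) (layer_kernel x s).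
Proof.
move=> x0; have p0 := sqrD_gt0 s x0.
pose g : R -> R := cst (x ^+ 2) + (@id R) ^+ 2.
have gE : g s = x ^+ 2 + s ^+ 2 by rewrite /g !fctE.
have -> : (fun s => - (x ^+ 2 + s ^+ 2) ^- 4) = - (fun t => ((g ^+ 4) t)^-1).
  by apply/funext => t; rewrite /g !fctE.
have nz4 : (g ^+ 4) s != 0 by rewrite exprfctE gE expf_neq0 ?gt_eqF.
apply: is_derive_eq.
rewrite exprfctE gE /layer_kernel /GRing.scale/=.
by field; rewrite gt_eqF.
Qed.

Lemma continuous_layer_kernel x : 0 < x -> continuous (layer_kernel x).
Proof.
move=> x0 s; rewrite /layer_kernel; apply: cvgM.
  by apply: cvgM; [exact: cvg_cst|exact: cvg_id].
apply: cvgV; first by rewrite expf_neq0 ?gt_eqF ?sqrD_gt0.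
apply: (cvg_comp (fun t => x ^+ 2 + t ^+ 2) (fun u => u ^+ 5)).
  by apply: cvgD; [exact: cvg_cst|exact: exprn_continuous].
exact: exprn_continuous.
Qed.

Lemma integral_layer_kernel x r : 0 < x -> 0 <= r ->
  (\int[lebesgue_measure]_(s in `[r, +oo[) (layer_kernel x s)%:E =
   ((x ^+ 2 + r ^+ 2) ^- 4)%:E)%E.
Proof.
move=> x0 r0.
have dF s := is_derive_layer_kernel s x0.
have cF : continuous (fun s => - (x ^+ 2 + s ^+ 2) ^- 4).
  move=> s; apply: differentiable_continuous; apply/derivable1_diffP.
  by have [] := dF s.
rewrite (@ge0_continuous_FTC2y _ (layer_kernel x)
  (fun s => - (x ^+ 2 + s ^+ 2) ^- 4) _ 0).
- by rewrite sub0e -EFinN opprK.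
- by move=> s rs; apply: layer_kernel_ge0; exact: le_trans rs.
- exact: continuous_subspaceT (continuous_layer_kernel x0).
- rewrite -oppr0; apply: cvgN.
  apply/cvgrPdist_lt => /= e e0; near=> s; rewrite sub0r normrN.
  have s1 : 1 <= s by near: s; apply: nbhs_pinfty_ge; exact: num_real.
  have se : e^-1 < s by near: s; apply: nbhs_pinfty_gt; exact: num_real.
  have s0 : 0 < s by exact: lt_le_trans s1.
  rewrite ger0_norm ?invr_ge0 ?exprn_ge0 ?addr_ge0 ?sqr_ge0//.
  rewrite -[e]invrK ltf_pV2 ?posrE ?invr_gt0 ?exprn_gt0 ?sqrD_gt0//.
  apply: (lt_le_trans se).
  have : s <= x ^+ 2 + s ^+ 2.
    by rewrite (le_trans (y := s ^+ 2)) ?lerDr ?sqr_ge0// expr2 ler_peMr// ltW.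
  move/le_trans; apply; apply: ler_eXnr => //.
  rewrite (le_trans (y := s ^+ 2)) ?lerDr ?sqr_ge0//.
  exact: exprn_ege1.
- by move=> s rs; have [] := dF s.
- apply: cvg_at_right_filter; exact: cF.
- by move=> s _; rewrite derive1E; exact: derive_val.
Unshelve. all: by end_near. Qed.
End layer.

Section layer_cake.
Context {R : realType} (m : {measure set R -> \bar R}).
Hypothesis mfin : forall s : R, (m `]-oo, s[%classic < +oo)%E.

Definition mass (s : R) : \bar R := m `[0, s[%classic.

(** [(x^2 + r^2)^-4] is the integral of the layer kernel over [s > r]; exchanging
    the integrations in [r] and [s] leaves the mass of [[0, s[]. *)
Lemma layer_cake (x : R) : 0 < x ->
  (\int[m]_(r in `[0%R, +oo[) ((x ^+ 2 + r ^+ 2) ^- 4)%:E =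
   \int[lebesgue_measure]_(s in `[0%R, +oo[) ((layer_kernel x s)%:E * mass s))%E.
Proof.
move=> x0.
have sf : sigma_finite setT m.
  exists (fun k : nat => `]-oo, k%:R[%classic); last by move=> k; split.
  apply/esym; rewrite -subTset => s _.
  exists (Num.truncn `|s|).+1 => //=.
  by rewrite in_itv/= (le_lt_trans (ler_norm s))// truncnS_gt.
pose sfn := isSFinite.Build _ _ _ (m : set R -> \bar R)
  (sfinite_measure_sigma_finite sf).
pose sfm := isSigmaFinite.Build _ _ _ (m : set R -> \bar R) sf.
pose m' : {sigma_finite_measure set R -> \bar R} := HB.pack (Measure.sort m) sfn sfm.
(* The domain 0 <= r < s of the double integral. *)
pose A : set (R * R) := [set z | 0 <= z.1 < z.2].
have mA : measurable A.
  have -> : A = (fun z : R * R => (0 <= z.1) && (z.1 < z.2)) @^-1` [set true].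
    by [].
  rewrite -[X in measurable X]setTI.
  apply: measurable_and => //.
    by apply: measurable_fun_ler => //; exact: measurable_fst.
  by apply: measurable_fun_ltr; [exact: measurable_fst|exact: measurable_snd].
pose f (z : R * R) : \bar R := ((layer_kernel x z.2)%:E * (\1_A z)%:E)%E.
have mk : measurable_fun setT (layer_kernel x).
  exact: continuous_measurable_fun (continuous_layer_kernel x0).
have mf : measurable_fun setT f.
  rewrite /f; apply: emeasurable_funM; apply/measurable_EFinP.
    exact: (measurableT_comp mk measurable_snd).
  exact: measurable_indic.
have f0 z : (0 <= f z)%E.
  rewrite /f -EFinM lee_fin indicE.
  have [zA|zA] := pselect (A z); last by rewrite memNset ?mulr0.
  case/andP: (zA) => h1 h2.
  by rewrite mem_set// mulr1 layer_kernel_ge0// (le_trans h1)// ltW.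
have := @fubini_tonelli _ _ _ _ _ m' lebesgue_measure f mf f0.
rewrite /= => H.
transitivity (\int[m']_x \int[lebesgue_measure]_y f (x, y))%E.
  rewrite [LHS]integral_mkcond/=; apply: eq_integral => r _.
  rewrite patchE mem_setE in_itv/= andbT.
  case: ifPn => r0.
    rewrite -(integral_layer_kernel x0 r0) -integral_itv_obnd_cbnd; last first.
      by apply: measurable_funTS; exact/measurable_EFinP.
    rewrite [LHS]integral_mkcond; apply: eq_integral => s _.
    rewrite patchE mem_setE in_itv/= andbT /f indicE/=.
    case: ifPn => rs; first by rewrite mem_set ?mule1//= /A/= r0 rs.
    by rewrite memNset ?mule0// /A/= r0 (negPf rs).
  rewrite integral0_eq// => s _.
  by rewrite /f indicE memNset ?mule0// /A/= (negPf r0).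
rewrite H [RHS]integral_mkcond/=; apply: eq_integral => s _.
rewrite patchE mem_setE in_itv/= andbT.
case: ifPn => s0.
  have -> : (fun r => f (r, s)) =
      (fun r => (layer_kernel x s)%:E * (\1_(`[0, s[%classic : set R) r)%:E)%E.
    apply/funext => r; rewrite /f/=; congr (_ * _%:E)%E; rewrite !indicE.
  rewrite ge0_integralZl//=; last by rewrite lee_fin layer_kernel_ge0.
    by rewrite integral_indic// setIT.
  by apply/measurable_EFinP; exact: measurable_indic.
rewrite integral0_eq// => r _.
rewrite /f indicE memNset ?mule0// /A/= => /andP[r0 rs].
by rewrite (le_trans r0 (ltW rs)) in s0.
Qed.
End layer_cake.

(** The analysis of the next sections needs only the profile [n], not the measure
    it comes from. *)
Section layer_integral.
Context {R : realType}.
Implicit Types (n : R -> \bar R) (x s : R).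
Local Notation mu := (@lebesgue_measure R).
Local Open Scope ereal_scope.

Definition layer_int n x : \bar R :=
  \int[mu]_(s in `[0%R, +oo[) ((layer_kernel x s)%:E * n s).

Lemma measurable_layer_kernelM n x (D : set R) : (0 < x)%R -> measurable_fun setT n ->
  measurable_fun D (fun s => (layer_kernel x s)%:E * n s).
Proof.
move=> x0 mn; apply: measurable_funTS; apply: emeasurable_funM => //.
apply/measurable_EFinP; apply: continuous_measurable_fun.
exact: continuous_layer_kernel.
Qed.

Lemma layer_kernelM_ge0 n x s : (forall s, 0 <= n s) -> (0 <= s)%R ->
  0 <= (layer_kernel x s)%:E * n s.
Proof. by move=> n0 s0; rewrite mule_ge0// lee_fin layer_kernel_ge0. Qed.

Lemma ray_split n x c d : (0 < x)%R -> (0 <= c)%R -> (c <= d)%R ->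
  measurable_fun setT n -> (forall s, 0 <= n s) ->
  \int[mu]_(s in `[c, +oo[) ((layer_kernel x s)%:E * n s) =
    \int[mu]_(s in `[c, d[) ((layer_kernel x s)%:E * n s) +
    \int[mu]_(s in `[d, +oo[) ((layer_kernel x s)%:E * n s).
Proof.
move=> x0 c0 cd mn n0.
have -> : `[c, +oo[%classic = `[c, d[%classic `|` `[d, +oo[%classic.
  by rewrite -itv_bndbnd_setU ?bnd_simp.
rewrite ge0_integral_setU//=.
- exact: measurable_layer_kernelM.
- by move=> s [|]; rewrite /= !in_itv/= => /andP[cs _];
    apply: layer_kernelM_ge0 => //; rewrite (le_trans c0)// (le_trans _ cs).
- apply/disj_setPS => s [] /=; rewrite !in_itv/= => /andP[_ sd]; rewrite andbT.
  by rewrite leNgt sd.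
Qed.

(** For [s >= d] one has [(1 + s^2) / (x^2 + s^2) <= 1 + d^-2], uniformly in [x];
    the layer kernel contains the fifth power of this ratio. *)
Definition tail_const d : R := ((1 + d ^- 2) ^+ 5)%R.

Lemma layer_kernel_tail x d s : (0 < x)%R -> (0 < d)%R -> (d <= s)%R ->
  (layer_kernel x s <= tail_const d * layer_kernel 1 s)%R.
Proof.
move=> x0 d0 ds; have s0 : (0 < s)%R by exact: lt_le_trans ds.
rewrite /layer_kernel /tail_const mulrCA ler_pM2l ?mulr_gt0// expr1n.
rewrite ler_pdivlMr ?exprn_gt0 ?addr_gt0 ?exprn_gt0//.
rewrite mulrC ler_pdivrMr ?exprn_gt0 ?addr_gt0 ?exprn_gt0// -exprMn.
rewrite ler_pXn2r ?nnegrE ?mulr_ge0 ?addr_ge0 ?exprn_ge0 ?invr_ge0 ?exprn_ge0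
  ?(ltW d0) ?(ltW s0) ?(ltW x0)//.
rewrite mulrDl mul1r.
have h : (1 <= d ^- 2 * s ^+ 2)%R.
  by rewrite mulrC ler_pdivlMr ?exprn_gt0// mul1r lerXn2r ?nnegrE ?(ltW d0) ?(ltW s0).
have := sqr_ge0 x.
have : (0 <= d ^- 2 * x ^+ 2)%R.
  by rewrite mulr_ge0 ?invr_ge0 ?exprn_ge0// ltW.
rewrite mulrDr; lra.
Qed.

(** Far from the boundary point the kernel stays bounded as [x] tends to 0, so
    this part disappears after multiplication by [x]. *)
Lemma layer_int_tail n x d : (0 < x)%R -> (0 < d)%R -> measurable_fun setT n ->
  (forall s, 0 <= n s) ->
  \int[mu]_(s in `[d, +oo[) ((layer_kernel x s)%:E * n s) <=
  (tail_const d)%:E * layer_int n 1.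
Proof.
move=> x0 d0 mn n0.
have C0 : (0 <= tail_const d)%R 
  by rewrite exprn_ge0// addr_ge0// invr_ge0 exprn_ge0// ltW.
rewrite /layer_int -ge0_integralZl//; last 2 first.
- exact: measurable_layer_kernelM.
- by move=> s /=; rewrite in_itv/= andbT => s0; apply: layer_kernelM_ge0.
apply: (@le_trans _ _
  (\int[mu]_(s in `[d, +oo[) ((tail_const d)%:E * ((layer_kernel 1 s)%:E * n s)))).
  apply: ge0_le_integral => //=.
  - move=> s; rewrite in_itv/= andbT => ds; apply: layer_kernelM_ge0 => //.
    exact: le_trans (ltW d0) ds.
  - exact: measurable_layer_kernelM.
  - by apply: measurable_funeM; exact: measurable_layer_kernelM.
  - move=> s; rewrite in_itv/= andbT => ds.
    rewrite muleA -EFinM lee_wpmul2r// lee_fin; exact: layer_kernel_tail.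
apply: ge0_subset_integral => //=.
- by apply: measurable_funeM; exact: measurable_layer_kernelM.
- by move=> s; rewrite in_itv/= andbT => s0; rewrite mule_ge0 ?lee_fin ?layer_kernelM_ge0.
- by move=> s /=; rewrite !in_itv/= !andbT; apply: le_trans; exact: ltW.
Qed.

(** Only the profile near 0 influences the behaviour as [x] tends to 0. *)
Lemma layer_int_le n1 n2 x d : (0 < x)%R -> (0 < d)%R ->
  measurable_fun setT n1 -> measurable_fun setT n2 ->
  (forall s, 0 <= n1 s) -> (forall s, 0 <= n2 s) ->
  (forall s, (0 < s < d)%R -> n1 s <= n2 s) ->
  layer_int n1 x <= layer_int n2 x + (tail_const d)%:E * layer_int n1 1.
Proof.
move=> x0 d0 m1 m2 n10 n20 n12.
rewrite /layer_int (ray_split x0 (lexx 0%R) (ltW d0) m1 n10).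
apply: leeD; last exact: layer_int_tail.
rewrite (ray_split x0 (lexx 0%R) (ltW d0) m2 n20).
apply: (@le_trans _ _ (\int[mu]_(s in `[0%R, d[) ((layer_kernel x s)%:E * n2 s))).
  apply: ge0_le_integral => //=.
  - by move=> s; rewrite in_itv/= => /andP[? _]; apply: layer_kernelM_ge0.
  - exact: measurable_layer_kernelM.
  - exact: measurable_layer_kernelM.
  - move=> s; rewrite in_itv/= => /andP[s0 sd].
    move: s0; rewrite le_eqVlt => /predU1P[<-|s0].
      by rewrite /layer_kernel mulr0 mul0r !mul0e.
    by rewrite lee_wpmul2l ?lee_fin ?layer_kernel_ge0 ?(ltW s0)// n12// s0.
rewrite leeDl// integral_ge0//= => s; rewrite in_itv/= andbT => ds.
by apply: layer_kernelM_ge0 => //; exact: le_trans (ltW d0) ds.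
Qed.

Lemma layer_int_lin n1 n2 (a b : R) x : (0 < x)%R -> (0 <= a)%R -> (0 <= b)%R ->
  measurable_fun setT n1 -> measurable_fun setT n2 ->
  (forall s, 0 <= n1 s) -> (forall s, 0 <= n2 s) ->
  layer_int (fun s => a%:E * n1 s + b%:E * n2 s) x =
  a%:E * layer_int n1 x + b%:E * layer_int n2 x.
Proof.
move=> x0 a0 b0 m1 m2 n10 n20.
rewrite /layer_int -!ge0_integralZl ?lee_fin//=; last 4 first.
- exact: measurable_layer_kernelM.
- by move=> s; rewrite in_itv/= andbT => s0; apply: layer_kernelM_ge0.
- exact: measurable_layer_kernelM.
- by move=> s; rewrite in_itv/= andbT => s0; apply: layer_kernelM_ge0.
rewrite -ge0_integralD//=; last 4 first.
- by move=> s; rewrite in_itv/= andbT => s0; rewrite mule_ge0 ?layer_kernelM_ge0 ?lee_fin.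
- by apply: measurable_funeM; exact: measurable_layer_kernelM.
- by move=> s; rewrite in_itv/= andbT => s0; rewrite mule_ge0 ?layer_kernelM_ge0 ?lee_fin.
- by apply: measurable_funeM; exact: measurable_layer_kernelM.
apply: eq_integral => s _.
by rewrite ge0_muleDr ?mule_ge0 ?lee_fin// !(muleCA (layer_kernel x s)%:E).
Qed.
End layer_integral.

(** * Behaviour of the potential as x tends to 0 *)

Section boundary_behaviour.
Context {R : realType}.
Local Notation mu := (@lebesgue_measure R).
Variables (n : R -> \bar R) (p : R -> R).
Hypotheses (mn : measurable_fun setT n) (n0 : forall s, (0 <= n s)%E).
Hypothesis pE : forall x, 0 < x -> (x%:E * layer_int n x = (p x)%:E)%E.

Let layer_intE x : 0 < x -> layer_int n x = (x^-1 * p x)%:E.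
Proof.
by move=> x0; rewrite EFinM -pE// muleA -EFinM mulVf ?mul1e// gt_eqF.
Qed.

(** Direct half of the finite case: [h] is a model profile with constant potential
    [K].  The second bound is written without [l - e], which may be negative,
    so that only nonnegative functions are integrated. *)
Lemma abelian_comparison (h : R -> \bar R) (l K : R) :
  measurable_fun setT h -> (forall s, (0 <= h s)%E) -> 0 <= l ->
  (forall x, 0 < x -> (x%:E * layer_int h x = K%:E)%E) ->
  (forall e, 0 < e -> \forall s \near 0^'+,
     (n s <= (l + e)%:E * h s)%E /\ (l%:E * h s <= n s + e%:E * h s)%E) ->
  p x @[x --> 0^'+] --> l * K.
Proof.
move=> mh h0 l0 hE H.
have hE' x : 0 < x -> layer_int h x = (x^-1 * K)%:E.
  by move=> x0; rewrite EFinM -(hE _ x0) muleA -EFinM mulVf ?mul1e// gt_eqF.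
have K0 : 0 <= K.
  rewrite -lee_fin -(hE _ ltr01) mul1e integral_ge0// => s/=.
  by rewrite in_itv/= andbT => s0; apply: layer_kernelM_ge0.
apply/cvgrPdist_le => /= eps eps0.
pose e := eps / 2 / (K + 1).
have e0 : 0 < e by rewrite !divr_gt0// ltr_wpDl.
have [d/= d0 Hd] := H e e0.
have Hd' s : (0 < s < d)%R ->
  (n s <= (l + e)%:E * h s)%E /\ (l%:E * h s <= n s + e%:E * h s)%E.
  move=> /andP[s0 sd]; apply: Hd => //=.
  by rewrite sub0r normrN gtr0_norm.
pose C := tail_const d * (p 1 + l * K).
near=> x.
have x0 : 0 < x by [].
have Cx : x * C <= eps / 2.
  have C0 : 0 < `|C| + 1 by rewrite ltr_wpDl.
  have : x < eps / 2 / (`|C| + 1).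
    by near: x; apply: nbhs_right_lt; rewrite !divr_gt0.
  rewrite ltr_pdivlMr// => /ltW; apply: le_trans.
  rewrite ler_pM2l// (le_trans (ler_norm _))// lerDl//.
have eK : e * K <= eps / 2.
  rewrite /e -mulrA ler_piMr ?divr_ge0 ?(ltW eps0)// mulrC ler_pdivrMr ?ltr_wpDl//.
  by rewrite mul1r lerDl.
(* In both bounds the summand with coefficient 0 only serves to apply
   linearity. *)
have up : p x <= (l + e) * K + x * (tail_const d * p 1).
  have m2 : measurable_fun setT (fun s => (l + e)%:E * h s + 0%:E * h s)%E.
    by apply: emeasurable_funD; exact: measurable_funeM.
  have /= := layer_int_le x0 d0 mn m2 n0.
  rewrite layer_int_lin// ?addr_ge0 ?(ltW e0)// hE'// !layer_intE//.
  rewrite -!EFinM -!EFinD lee_fin => /(_ _ _)/wrap[||].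
  - by move=> s; rewrite adde_ge0// mule_ge0// lee_fin addr_ge0// ltW.
  - by move=> s /Hd'[]; rewrite mul0e adde0.
  rewrite -(ler_pM2l x0) mulVKf ?gt_eqF// => /le_trans; apply.
  by rewrite mul0r addr0 invr1 mul1r mulrDr mulrCA mulVKf ?gt_eqF.
have low : l * K <= p x + e * K + x * (tail_const d * (l * K)).
  have m1 : measurable_fun setT (fun s => l%:E * h s + 0%:E * h s)%E.
    by apply: emeasurable_funD; exact: measurable_funeM.
  have m2 : measurable_fun setT (fun s => 1%:E * n s + e%:E * h s)%E.
    by apply: emeasurable_funD; exact: measurable_funeM.
  have /= := layer_int_le x0 d0 m1 m2.
  rewrite !layer_int_lin ?(ltW e0)// !hE'// !layer_intE//.
  rewrite -!EFinM -!EFinD lee_fin => /(_ _ _ _)/wrap[|||].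
  - by move=> s; rewrite adde_ge0// mule_ge0// lee_fin ltW.
  - by move=> s; rewrite adde_ge0// mule_ge0// lee_fin ltW.
  - by move=> s /Hd'[]; rewrite mul0e adde0 mul1e.
  rewrite -(ler_pM2l x0) !mul0r !addr0 mulrCA mulVKf ?gt_eqF// => /le_trans; apply.
  rewrite !mulrDr mul1r mulVKf ?gt_eqF// (mulrCA x e) mulVKf ?gt_eqF//.
  by rewrite invr1 mul1r.
have t0 : 0 <= tail_const d.
  by rewrite exprn_ge0// addr_ge0// invr_ge0 exprn_ge0// ltW.
have p0 : 0 <= p 1.
  rewrite -lee_fin -pE// mul1e integral_ge0// => s/=.
  by rewrite in_itv/= andbT => s0; apply: layer_kernelM_ge0.
have xp : 0 <= x * (tail_const d * p 1).
  by apply: mulr_ge0; [exact: ltW|exact: mulr_ge0].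
have xl : 0 <= x * (tail_const d * (l * K)).
  by apply: mulr_ge0; [exact: ltW|apply: mulr_ge0 => //; exact: mulr_ge0].
rewrite /C !mulrDr in Cx.
by rewrite ler_norml; apply/andP; split; lra.
Unshelve. all: by end_near. Qed.
End boundary_behaviour.

Section infinite.
Context {R : realType}.
Local Notation mu := (@lebesgue_measure R).
Variables (n : R -> \bar R) (p : R -> R).
Hypotheses (mn : measurable_fun setT n) (n0 : forall s, (0 <= n s)%E).
Hypothesis pE : forall x, 0 < x -> (x%:E * layer_int n x = (p x)%:E)%E.
Hypothesis n_nd : forall s t, s <= t -> (n s <= n t)%E.

Definition density_int (a t : R) : \bar R :=
  (\int[mu]_(s in `[t, a]) ((s ^- 9)%:E * n s))%E.

Let measurable_density (t a : R) : 0 < t ->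
  measurable_fun `[t, a] (fun s => ((s ^- 9)%:E * n s)%E).
Proof.
move=> t0; apply: emeasurable_funM; last exact: measurable_funTS.
apply/measurable_EFinP.
have [mS mc] : measurable (`]0, +oo[%classic : set R) /\
    `[t, a] `<=` (`]0, +oo[%classic : set R).
  split=> // s /=; rewrite !in_itv/= andbT => /andP[ts _].
  exact: lt_le_trans ts.
apply: measurable_funS mS mc _.
apply: open_continuous_measurable_fun; first exact: interval_open.
move=> s; rewrite inE/= in_itv/= andbT => s0.
apply: cvgV; first by rewrite expf_neq0 ?gt_eqF.
exact: exprn_continuous.
Qed.

Let density_ge0 (t a s : R) : 0 < t -> s \in `[t, a] -> (0 <= (s ^- 9)%:E * n s)%E.
Proof.
move=> t0; rewrite in_itv/= => /andP[ts _].
by rewrite mule_ge0// lee_fin invr_ge0 exprn_ge0// (le_trans (ltW t0)).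
Qed.

(** On [s >= x] the denominator is at most [(2 s^2)^5], so the layer kernel is at
    least [s^-9 / 4]. *)
Let p_lower (a x : R) : 0 < x -> (x%:E * density_int a x <= 4%:E * (p x)%:E)%E.
Proof.
move=> x0; rewrite -pE// muleCA lee_wpmul2l ?lee_fin ?(ltW x0)//.
rewrite -lee_pdivrMl// /density_int -ge0_integralZl//=; last 2 first.
- exact: measurable_density.
- by move=> s; exact: density_ge0.
rewrite /layer_int.
apply: (@le_trans _ _ (\int[mu]_(s in `[x, a]) ((layer_kernel x s)%:E * n s))%E).
  apply: ge0_le_integral => //=.
  - by move=> s xs; rewrite mule_ge0 ?(density_ge0 x0 xs)// lee_fin invr_ge0.
  - by apply: measurable_funeM; exact: measurable_density.
  - exact: measurable_layer_kernelM.
  - move=> s; rewrite in_itv/= => /andP[xs _].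
    have s0 : 0 < s by exact: lt_le_trans xs.
    rewrite muleA -EFinM lee_wpmul2r// lee_fin /layer_kernel.
    rewrite ler_pdivlMr ?exprn_gt0 ?sqrD_gt0//.
    have : (x ^+ 2 + s ^+ 2) ^+ 5 <= (2 * s ^+ 2) ^+ 5.
      have s2 := sqr_ge0 s; have x2 := sqr_ge0 x.
      apply: lerXn2r; rewrite ?nnegrE ?addr_ge0 ?(mulr_ge0 _ s2)//.
      rewrite mulr_natl mulr2n lerD2r; apply: lerXn2r => //; rewrite nnegrE ltW//.
    move=> H5; apply: (@le_trans _ _ (4^-1 * s ^- 9 * (2 * s ^+ 2) ^+ 5)).
      by rewrite ler_pM2l// mulr_gt0 ?invr_gt0 ?exprn_gt0.
    rewrite le_eqVlt; apply/orP; left; apply/eqP.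
    by field; rewrite gt_eqF.
apply: ge0_subset_integral => //=.
- exact: measurable_layer_kernelM.
- by move=> s; rewrite in_itv/= andbT => s0; apply: layer_kernelM_ge0.
- move=> s /=; rewrite !in_itv/= andbT => /andP[xs _].
  by rewrite (le_trans _ xs)// ltW.
Qed.

(** Since [n] is monotone, [n x] is at most its mean over [[x, 2 x]], where
    [s^-9 >= 2^-9 x^-9]. *)
Let mass_le_tail (a x : R) : 0 < x -> 2 * x <= a ->
  ((x ^- 8)%:E * n x <= (2 ^+ 9)%:E * density_int a x)%E.
Proof.
move=> x0 xa.
rewrite -lee_pdivrMl ?exprn_gt0// /density_int.
apply: (@le_trans _ _ (\int[mu]_(s in `[x, (2 * x)%R]) ((s ^- 9)%:E * n s))%E).
  apply: (@le_trans _ _ (\int[mu]_(s in `[x, (2 * x)%R]) ((((2 * x) ^- 9)%:E * n x)))%E).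
    rewrite integral_cst//= lebesgue_measure_itv/= lte_fin ltr_pMl// ltr1n.
    rewrite -EFinB muleAC muleA -!EFinM le_eqVlt; apply/orP; left; apply/eqP.
    by congr (_%:E * _)%E; field; rewrite gt_eqF.
  apply: ge0_le_integral => //=.
  - by move=> s _; rewrite mule_ge0// lee_fin invr_ge0 exprn_ge0// mulr_ge0// ltW.
  - exact: measurable_density.
  - move=> s; rewrite in_itv/= => /andP[xs sx].
    have s0 : 0 < s by exact: lt_le_trans xs.
    apply: lee_pmul => //; last exact: n_nd.
      by rewrite lee_fin invr_ge0 exprn_ge0// mulr_ge0// ltW.
    rewrite lee_fin lef_pV2 ?posrE ?exprn_gt0 ?mulr_gt0//.
    by rewrite ler_pXn2r ?nnegrE ?mulr_ge0 ?(ltW x0) ?(ltW s0).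
apply: ge0_subset_integral => //=.
- exact: measurable_density.
- by move=> s; exact: density_ge0.
- move=> s /=; rewrite !in_itv/= => /andP[-> sx]/=; exact: le_trans xa.
Qed.

(** Three regions: for [s < x] the kernel is at most [8 x^-9] and
    [mass_le_tail] applies; for [x <= s < a] it is at most [8 s^-9]; the rest is
    the tail.  Any constant from [2^12 + 8] on would do. *)
Let layer_int_upper (a x : R) : 0 < x -> 2 * x <= a ->
  (layer_int n x <=
   (2 ^+ 13)%:E * density_int a x + (tail_const a)%:E * layer_int n 1)%E.
Proof.
move=> x0 xa.
have xa' : x <= a by rewrite (le_trans _ xa)// ler_peMl ?ler1n// ltW.
have a0 : 0 < a by exact: lt_le_trans xa'.
rewrite /layer_int (ray_split x0 (lexx 0) (ltW x0) mn n0).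
rewrite (ray_split x0 (ltW x0) xa' mn n0).
have near0 : (\int[mu]_(s in `[0%R, x[) ((layer_kernel x s)%:E * n s) <=
    (2 ^+ 12)%:E * density_int a x)%E.
  apply: (@le_trans _ _ (8%:E * ((x ^- 8)%:E * n x))%E); last first.
    rewrite [leRHS](_ : _ = 8%:E * ((2 ^+ 9)%:E * density_int a x))%E.
      by rewrite lee_wpmul2l ?lee_fin//; exact: mass_le_tail.
    by rewrite muleA -EFinM; congr (_%:E * _)%E; lra.
  apply: (@le_trans _ _ (\int[mu]_(s in `[0%R, x[) ((8 * x ^- 9)%:E * n x))%E).
    apply: ge0_le_integral => //=.
    - by move=> s; rewrite in_itv/= => /andP[s0 _]; apply: layer_kernelM_ge0.
    - exact: measurable_layer_kernelM.
    - move=> s; rewrite in_itv/= => /andP[s0 sx].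
      apply: lee_pmul; rewrite ?lee_fin ?layer_kernel_ge0//; last exact/n_nd/ltW.
      rewrite /layer_kernel -mulrA ler_pM2l//.
      have H5 : (x ^+ 2) ^+ 5 <= (x ^+ 2 + s ^+ 2) ^+ 5.
        have s2 := sqr_ge0 s; have x2 := sqr_ge0 x.
        by apply: lerXn2r; rewrite ?nnegrE ?addr_ge0// lerDl.
      apply: (@le_trans _ _ (x / (x ^+ 2) ^+ 5)).
        apply: ler_pM => //; first by rewrite invr_ge0 exprn_ge0// ltW// sqrD_gt0.
          exact: ltW.
        by rewrite lef_pV2 ?posrE ?exprn_gt0 ?sqrD_gt0.
      by rewrite le_eqVlt; apply/orP; left; apply/eqP; field; rewrite gt_eqF.
  rewrite integral_cst//= lebesgue_measure_itv/= lte_fin x0 sube0.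
  rewrite muleAC muleA -!EFinM le_eqVlt; apply/orP; left; apply/eqP.
  by congr (_%:E * _)%E; field; rewrite gt_eqF.
have mid : (\int[mu]_(s in `[x, a[) ((layer_kernel x s)%:E * n s) <=
    8%:E * density_int a x)%E.
  rewrite /density_int -ge0_integralZl//=; last 2 first.
  - exact: measurable_density.
  - by move=> s; exact: density_ge0.
  apply: (@le_trans _ _ (\int[mu]_(s in `[x, a]) ((layer_kernel x s)%:E * n s))%E).
    apply: ge0_subset_integral => //=.
    - exact: measurable_layer_kernelM.
    - move=> s; rewrite in_itv/= => /andP[xs _]; apply: layer_kernelM_ge0 => //.
      by rewrite (le_trans _ xs)// ltW.
    - by move=> s /=; rewrite !in_itv/= => /andP[-> /ltW].
  apply: ge0_le_integral => //=.
  - move=> s; rewrite in_itv/= => /andP[xs _]; apply: layer_kernelM_ge0 => //.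
    by rewrite (le_trans _ xs)// ltW.
  - exact: measurable_layer_kernelM.
  - by apply: measurable_funeM; exact: measurable_density.
  - move=> s; rewrite in_itv/= => /andP[xs _].
    have s0 : 0 < s by exact: lt_le_trans xs.
    rewrite muleA -EFinM lee_wpmul2r// lee_fin /layer_kernel -mulrA ler_pM2l//.
    rewrite ler_pdivrMr ?exprn_gt0 ?sqrD_gt0//.
    have H5 : (s ^+ 2) ^+ 5 <= (x ^+ 2 + s ^+ 2) ^+ 5.
      have s2 := sqr_ge0 s; have x2 := sqr_ge0 x.
      by apply: lerXn2r; rewrite ?nnegrE ?addr_ge0// lerDr.
    apply: (@le_trans _ _ (s ^- 9 * (s ^+ 2) ^+ 5)).
      by rewrite le_eqVlt; apply/orP; left; apply/eqP; field; rewrite gt_eqF.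
    by rewrite ler_pM2l// invr_gt0 exprn_gt0.
rewrite addeA; apply: leeD; last exact: layer_int_tail.
apply: (le_trans (leeD near0 mid)).
have J0 : (0 <= density_int a x)%E.
  by apply: integral_ge0 => s /=; exact: density_ge0.
rewrite -ge0_muleDl ?lee_fin// -EFinD lee_wpmul2r// lee_fin; lra.
Qed.

Let p_upper (a x : R) : 0 < x -> 2 * x <= a ->
  ((p x)%:E <=
   (2 ^+ 13)%:E * (x%:E * density_int a x) + (x * (tail_const a * p 1))%:E)%E.
Proof.
move=> x0 xa; rewrite -pE//.
have -> : (x * (tail_const a * p 1))%:E =
    (x%:E * ((tail_const a)%:E * layer_int n 1))%E.
  by rewrite !EFinM -pE// mul1e.
have L0 y : (0 <= layer_int n y)%E.
  rewrite integral_ge0// => s/=; rewrite in_itv/= andbT; exact: layer_kernelM_ge0.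
have C0 : 0 <= tail_const a by rewrite exprn_ge0// addr_ge0// invr_ge0 sqr_ge0.
rewrite muleCA -ge0_muleDr ?mule_ge0 ?lee_fin//; last first.
  by apply: integral_ge0 => s /=; exact: density_ge0.
by rewrite lee_wpmul2l ?lee_fin ?(ltW x0)//; exact: layer_int_upper.
Qed.

(** The two quantities dominate each other up to constants and an [O(x)] term. *)
Lemma infinite_limit_density_int (a : R) : 0 < a ->
  ((p x)%:E @[x --> 0^'+] --> +oo%E) <->
  ((t%:E * density_int a t)%E @[t --> 0^'+] --> +oo%E).
Proof.
move=> a0; split=> /cvgeyPge H; apply/cvgeyPge => A; near=> x.
- have x0 : 0 < x by [].
  have xa : 2 * x <= a.
    have : x < a / 2 by near: x; apply: nbhs_right_lt; rewrite divr_gt0.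
    by rewrite ltr_pdivlMr// mulrC => /ltW.
  have x1 : x * (tail_const a * p 1) <= 1.
    set C := _ * p 1; have C0 : 0 < `|C| + 1 by rewrite ltr_wpDl.
    have : x < 1 / (`|C| + 1) by near: x; apply: nbhs_right_lt; rewrite !divr_gt0.
    rewrite ltr_pdivlMr// => /ltW; apply: le_trans.
    by rewrite ler_pM2l// (le_trans (ler_norm _))// lerDl.
  have pA : ((2 ^+ 13 * A + 1)%:E <= (p x)%:E)%E by near: x; exact: H.
  have := le_trans pA (p_upper x0 xa).
  have xJ0 : (0 <= x%:E * density_int a x)%E.
    rewrite mule_ge0// ?lee_fin ?(ltW x0)//.
    by apply: integral_ge0 => s /=; exact: density_ge0.
  move: xJ0; case: (x%:E * density_int a x)%E => [J| |]//; rewrite ?lee_fin ?leey// => J0.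
  lra.
- have x0 : 0 < x by [].
  have : ((4 * A)%:E <= x%:E * density_int a x)%E by near: x; exact: H.
  by move/le_trans => /(_ _ (p_lower a x0)); rewrite EFinM lee_pmul2l.
Unshelve. all: by end_near. Qed.
End infinite.

(** * Averages of dilated functions *)

Section averages.
Context {R : realType}.
Implicit Types (m : {measure set R -> \bar R}) (phi psi : R -> R) (x u r : R).

Definition weight r : R := (1 + r ^+ 2)^-1.

Local Notation D := (`[0%R, +oo[%classic : set R).

(** The factor [x^-7] makes the average independent of [x] when [m] is the radial
    distribution of Lebesgue measure on [R^7]. *)
Definition avg m x phi : R := x ^- 7 * \int[m]_(r in D) phi (r / x).

(** The class on which averages are finite as soon as the Poisson integral is:
    [x^-8 weight(r / x)^4] is the kernel [(x^2 + r^2)^-4]. *)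
Definition admissible phi : Prop :=
  measurable_fun setT phi /\ exists C, forall r, `|phi r| <= C * weight r ^+ 4.

Lemma weight_gt0 r : 0 < weight r.
Proof. by rewrite invr_gt0 ltr_wpDr ?sqr_ge0. Qed.

Lemma weight_le1 r : weight r <= 1.
Proof. by rewrite invf_le1 ?ltr_wpDr ?sqr_ge0// lerDl sqr_ge0. Qed.

Lemma weight_div r x : 0 < x -> weight (r / x) <= (1 + x ^+ 2) * weight r.
Proof.
move=> x0; rewrite /weight.
have r2 := sqr_ge0 r; have x2 : 0 < x ^+ 2 by rewrite exprn_gt0.
rewrite ler_pdivlMr ?ltr_wpDr// mulrC ler_pdivrMr; last first.
  by rewrite ltr_wpDr ?sqr_ge0.
rewrite expr_div_n mulrDr mulr1 mulrCA mulrDl divff ?gt_eqF// mul1r.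
rewrite mulrDr mulr1.
have : 0 <= r ^+ 2 / x ^+ 2 by rewrite divr_ge0// ltW.
lra.
Qed.

Lemma continuous_weight : continuous weight.
Proof.
move=> s; apply: cvgV; first by rewrite gt_eqF// ltr_wpDr ?sqr_ge0.
by apply: cvgD; [exact: cvg_cst|exact: exprn_continuous].
Qed.

Lemma admissible_weightX k : admissible (fun r => weight r ^+ (4 + k)).
Proof.
split.
  apply: measurable_funX; apply: continuous_measurable_fun.
  exact: continuous_weight.
exists 1 => r; rewrite mul1r ger0_norm ?exprn_ge0 ?(ltW (weight_gt0 r))//.
by rewrite exprD ler_piMr ?exprn_ge0 ?exprn_ile1 ?weight_le1 ?(ltW (weight_gt0 r)).
Qed.

Lemma admissible_lin a b phi psi : admissible phi -> admissible psi ->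
  admissible (fun r => a * phi r + b * psi r).
Proof.
move=> [mp [C HC]] [mq [C' HC']]; split.
  by apply: measurable_funD; apply: measurable_funM.
exists (`|a| * C + `|b| * C') => r.
rewrite (le_trans (ler_normD _ _))// !normrM mulrDl -!mulrA.
by apply: lerD; rewrite ler_wpM2l.
Qed.

Lemma admissible_div x phi : 0 < x -> admissible phi -> admissible (fun r => phi (r / x)).
Proof.
move=> x0 [mp [C HC]]; split.
  apply: (measurableT_comp mp).
  by apply: measurable_funM.
exists (`|C| * (1 + x ^+ 2) ^+ 4) => r.
rewrite (le_trans (HC _))// (le_trans (ler_wpM2r _ (ler_norm C)))//.
  by rewrite exprn_ge0 ?(ltW (weight_gt0 _)).
rewrite -mulrA ler_wpM2l// -exprMn; apply: lerXn2r; last exact: weight_div.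
  by rewrite nnegrE ltW// weight_gt0.
by rewrite nnegrE mulr_ge0 ?(ltW (weight_gt0 _))// addr_ge0// sqr_ge0.
Qed.

Section one_measure.
Variable m : {measure set R -> \bar R}.
Hypothesis mw : m.-integrable D (EFin \o (fun r => weight r ^+ 4)).

Lemma admissible_integrable phi : admissible phi -> m.-integrable D (EFin \o phi).
Proof.
move=> [mp [C HC]].
apply: (@le_integrable _ _ _ _ _ _ _ (EFin \o (fun r => C * weight r ^+ 4))) => //.
- by apply/measurable_EFinP; exact: measurable_funTS.
- move=> r _ /=; rewrite lee_fin (le_trans (HC r))//; exact: ler_norm.
- rewrite (_ : _ \o _ = (fun r => C%:E * (weight r ^+ 4)%:E)%E); last first.
    by apply/funext => r /=; rewrite EFinM.
  exact: integrableZl.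
Qed.

Lemma avg_lin x a b phi psi : 0 < x -> admissible phi -> admissible psi ->
  avg m x (fun r => a * phi r + b * psi r) = a * avg m x phi + b * avg m x psi.
Proof.
move=> x0 ap aq.
have ip := admissible_integrable (admissible_div x0 ap).
have iq := admissible_integrable (admissible_div x0 aq).
have ip' := admissible_integrable
  (admissible_lin a 0 (admissible_div x0 ap) (admissible_div x0 aq)).
have iq' := admissible_integrable
  (admissible_lin 0 b (admissible_div x0 ap) (admissible_div x0 aq)).
rewrite /avg RintegralD//; last 2 first.
- by apply: eq_integrable ip' => // r _ /=; rewrite mul0r addr0.
- by apply: eq_integrable iq' => // r _ /=; rewrite mul0r add0r.
by rewrite !RintegralZl// mulrDr !(mulrCA (x ^- 7)).
Qed.

Lemma avg_le x phi psi : 0 < x -> admissible phi -> admissible psi ->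
  (forall r, 0 <= r -> phi r <= psi r) -> avg m x phi <= avg m x psi.
Proof.
move=> x0 ap aq h; rewrite /avg ler_wpM2l ?invr_ge0 ?exprn_ge0 ?(ltW x0)//.
apply: le_Rintegral => //.
- exact: admissible_integrable (admissible_div x0 ap).
- exact: admissible_integrable (admissible_div x0 aq).
by move=> r /=; rewrite in_itv/= andbT => r0; rewrite h// divr_ge0// ltW.
Qed.

Lemma avg_div x u phi : 0 < x -> 0 < u ->
  avg m x (fun r => phi (r / u)) = u ^+ 7 * avg m (u * x) phi.
Proof.
move=> x0 u0; rewrite /avg mulrA; congr (_ * _).
  by field; rewrite !gt_eqF.
by apply: eq_Rintegral => r _; congr phi; field; rewrite !gt_eqF.
Qed.

End one_measure.
End averages.

Lemma admissible_poly {R : realType} (Q : {poly R}) k :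
  admissible (fun r => weight r ^+ (4 + k) * Q.[weight r]).
Proof.
elim/poly_ind : Q k => [k|P c IH k].
  under eq_fun do rewrite horner0 mulr0.
  split; first exact: measurable_cst.
  by exists 0 => r; rewrite normr0 mul0r.
have -> : (fun r => weight r ^+ (4 + k) * (P * 'X + c%:P).[weight r]) =
    (fun r => 1 * (weight r ^+ (4 + k.+1) * P.[weight r]) + c * weight r ^+ (4 + k)).
  by apply/funext => r; rewrite hornerMXaddC addnS (exprS _ (4 + k)); ring.
by apply: admissible_lin => //; exact: admissible_weightX.
Qed.

(** * Polynomial approximation of a step *)

Section step_approximation.
Context {R : realType}.
Implicit Types (w t : R) (k : nat).

(** [(1 - w^N)^(2^N)] behaves like [exp (- (2 w)^N)], so for large [N] it is close
    to 1 when [w < 1/2] and to 0 when [w > 1/2].  Taking [N = 4 + k] makes the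
    polynomial divisible by [w^4]. *)
Definition step_approx k w : R := 1 - (1 - w ^+ (4 + k)) ^+ (2 ^ (4 + k)).

Lemma step_approx_poly k :
  exists Q : {poly R}, forall w, step_approx k w = w ^+ 4 * Q.[w].
Proof.
exists ('X^k * \sum_(i < 2 ^ (4 + k)) (1 - 'X^(4 + k)) ^+ i) => w.
rewrite /step_approx -opprB subrX1 hornerM horner_sum hornerXn.
under [in RHS]eq_bigr do rewrite horner_exp !hornerE.
by rewrite exprD; ring.
Qed.

Let bernoulli t n : -1 <= t -> 1 + n%:R * t <= (1 + t) ^+ n.
Proof.
move=> t1; elim: n => [|n IH]; first by rewrite mul0r addr0 expr0.
rewrite exprS; have t0 : 0 <= 1 + t by lra.
apply: le_trans (ler_wpM2l t0 IH).
have : 0 <= n%:R * t ^+ 2 by rewrite mulr_ge0// sqr_ge0.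
rewrite -natr1; lra.
Qed.

(** Bernoulli's inequality for [1 - w^N]. *)
Lemma step_approx_le k w : 0 <= w <= 1 -> step_approx k w <= (2 * w) ^+ (4 + k).
Proof.
move=> /andP[w0 w1]; rewrite /step_approx.
have wn : w ^+ (4 + k) <= 1 by exact: exprn_ile1.
have := @bernoulli (- w ^+ (4 + k)) (2 ^ (4 + k)).
by rewrite lerN2 => /(_ wn); rewrite exprMn natrX; lra.
Qed.

(** Bernoulli's inequality for [1 + w^N], since [(1 - a)^n (1 + a)^n <= 1]. *)
Lemma step_approx_ge k w : 0 < w <= 1 ->
  1 - ((2 * w) ^+ (4 + k))^-1 <= step_approx k w.
Proof.
move=> /andP[w0 w1]; rewrite /step_approx lerD2l lerN2.
set a := w ^+ (4 + k); set N := (2 ^ (4 + k))%N.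
have a0 : 0 < a by rewrite exprn_gt0.
have a1 : a <= 1 by apply: exprn_ile1 => //; exact: ltW.
have h : (1 - a) ^+ N * (1 + a) ^+ N <= 1.
  by rewrite -exprMn exprn_ile1//; nra.
have b : (2 * w) ^+ (4 + k) <= (1 + a) ^+ N.
  rewrite exprMn -natrX -/a -/N; apply: le_trans (@bernoulli a N _); lra.
have p : 0 < (2 * w) ^+ (4 + k) by rewrite exprn_gt0// mulr_gt0.
rewrite -[leRHS]mul1r ler_pdivlMr//; apply: le_trans h.
by rewrite ler_wpM2l// exprn_ge0// subr_ge0.
Qed.

Lemma step_approx_ge0 k w : 0 <= w <= 1 -> 0 <= step_approx k w.
Proof.
move=> /andP[w0 w1]; rewrite subr_ge0 exprn_ile1//.
  by rewrite subr_ge0 exprn_ile1.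
by rewrite lerBlDr lerDl exprn_ge0.
Qed.

Lemma step_approx_le1 k w : 0 <= w <= 1 -> step_approx k w <= 1.
Proof.
move=> /andP[w0 w1]; rewrite lerBlDr lerDl exprn_ge0// subr_ge0.
exact: exprn_ile1.
Qed.

End step_approximation.

(** * The Tauberian theorem *)

(** [m] is compared with the homogeneous measure [m0]; the hypothesis on [m] is
    [avg_cvg_weight4] below. *)
Section tauberian.
Context {R : realType}.
Implicit Types (phi psi : R -> R) (x u r : R).
Local Notation D := (`[0%R, +oo[%classic : set R).
Variables (m m0 : {measure set R -> \bar R}) (l : R).
Hypothesis mw : m.-integrable D (EFin \o (fun r => weight r ^+ 4)).
Hypothesis m0w : m0.-integrable D (EFin \o (fun r => weight r ^+ 4)).
Hypothesis m0_scale : forall x phi, 0 < x -> admissible phi ->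
  avg m0 x phi = avg m0 1 phi.
Hypothesis l0 : 0 <= l.

Definition avg_cvg phi := avg m x phi @[x --> 0^'+] --> l * avg m0 1 phi.

Lemma avg_cvg_lin a b phi psi :
  admissible phi -> admissible psi -> avg_cvg phi -> avg_cvg psi ->
  avg_cvg (fun r => a * phi r + b * psi r).
Proof.
move=> ap aq cp cq; rewrite /avg_cvg avg_lin//.
rewrite mulrDr (mulrCA l a) (mulrCA l b).
have : a * avg m x phi + b * avg m x psi @[x --> 0^'+] -->
   a * (l * avg m0 1 phi) + b * (l * avg m0 1 psi).
  by apply: cvgD; apply: cvgM => //; exact: cvg_cst.
apply: cvg_trans; apply: near_eq_cvg; near=> x.
by rewrite avg_lin.
Unshelve. all: by end_near. Qed.

Lemma avg_cvg_div u phi : 0 < u -> admissible phi -> avg_cvg phi ->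
  avg_cvg (fun r => phi (r / u)).
Proof.
move=> u0 ap cp; rewrite /avg_cvg avg_div// m0_scale ?mulr1// mulrCA.
have h : u ^+ 7 * avg m x phi @[x --> 0^'+] --> u ^+ 7 * (l * avg m0 1 phi).
  by apply: cvgM => //; exact: cvg_cst.
have ux : u * x @[x --> 0^'+] --> 0^'+.
  move=> A [d d0 dA]; exists (d / u); first by rewrite /= divr_gt0.
  move=> x /= xd x0; apply: dA; last by rewrite mulr_gt0.
  move: xd; rewrite /= !sub0r !normrN !gtr0_norm ?mulr_gt0//.
  by rewrite ltr_pdivlMr// mulrC.
have := cvg_comp _ _ ux h.
apply: cvg_trans; apply: near_eq_cvg; near=> x => /=.
by rewrite avg_div.
Unshelve. all: by end_near. Qed.

(** Positivity of [m] enters here: approximation is only needed in the mean with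
    respect to [m0], because monotonicity transfers it to [m]. *)
Lemma avg_cvg_sandwich phi : admissible phi ->
  (forall e, 0 < e -> exists phi1 phi2, [/\ admissible phi1 /\ avg_cvg phi1,
     admissible phi2 /\ avg_cvg phi2, forall r, 0 <= r -> phi1 r <= phi r <= phi2 r &
     avg m0 1 phi2 - avg m0 1 phi1 <= e]) ->
  avg_cvg phi.
Proof.
move=> ap H; apply/cvgrPdist_le => /= eps eps0.
have l1 : 0 < l + 1 by rewrite ltr_wpDl.
have [|p1 [p2 [[a1 c1] [a2 c2] h12 he]]] := H (eps / 2 / (l + 1)).
  by rewrite !divr_gt0.
move/cvgrPdist_le : c1 => /(_ (eps / 2)) c1.
move/cvgrPdist_le : c2 => /(_ (eps / 2)) c2.
have le1 : l * (avg m0 1 p2 - avg m0 1 p1) <= eps / 2.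
  rewrite (le_trans (ler_wpM2l l0 he))// mulrCA ler_piMr ?divr_ge0 ?(ltW eps0)//.
  by rewrite ler_pdivrMr// mul1r lerDl.
have h1 : l * avg m0 1 p1 <= l * avg m0 1 phi.
  by rewrite ler_wpM2l// avg_le// => r /h12/andP[].
have h2 : l * avg m0 1 phi <= l * avg m0 1 p2.
  by rewrite ler_wpM2l// avg_le// => r /h12/andP[].
near=> x.
have x0 : 0 < x by [].
have k1 : avg m x p1 <= avg m x phi by rewrite avg_le// => r /h12/andP[].
have k2 : avg m x phi <= avg m x p2 by rewrite avg_le// => r /h12/andP[].
have : `|l * avg m0 1 p1 - avg m x p1| <= eps / 2.
  by near: x; apply: c1; rewrite divr_gt0.
have : `|l * avg m0 1 p2 - avg m x p2| <= eps / 2.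
  by near: x; apply: c2; rewrite divr_gt0.
rewrite !ler_norml => /andP[? ?] /andP[? ?]; move: le1; rewrite mulrBr => le1.
by apply/andP; split; lra.
Unshelve. all: by end_near. Qed.

Hypothesis avg_cvg_weight4 : avg_cvg (fun r => weight r ^+ 4).

(** Both sides of the mean value inequality for [y^k - z^k], in the form of the
    geometric sum. *)
Let sum_ge (y z : R) (k : nat) : 0 <= z -> z <= y ->
  k%:R * z ^+ k.-1 <= \sum_(i < k) y ^+ (k.-1 - i) * z ^+ i <= k%:R * y ^+ k.-1.
Proof.
move=> z0 zy; have y0 := le_trans z0 zy.
have c (a : R) : k%:R * a = \sum_(i < k) a.
  by rewrite sumr_const card_ord mulr_natl.
rewrite !c; apply/andP; split; apply: ler_sum => i _.
  have ik : (i <= k.-1)%N by rewrite -ltnS prednK//; exact: leq_ltn_trans (ltn_ord i).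
  rewrite -{1}(subnK ik) exprD ler_wpM2r ?exprn_ge0//.
  by apply: lerXn2r.
have ik : (i <= k.-1)%N by rewrite -ltnS prednK//; exact: leq_ltn_trans (ltn_ord i).
rewrite -{2}(subnK ik) exprD ler_wpM2l ?exprn_ge0//.
by apply: lerXn2r.
Qed.

(** With [y = weight r] and [z = 1/(1 + h + r^2)], which is a multiple of a dilated
    weight, [(y^j - z^j) / (j h)] approximates [y^(j + 1)] within [j h y^j]. *)
Lemma avg_cvg_weightX k : avg_cvg (fun r => weight r ^+ (4 + k)).
Proof.
elim: k => [|k IH]; first by rewrite addn0.
apply: avg_cvg_sandwich; first exact: admissible_weightX.
rewrite addnS; have aj := @admissible_weightX R k.
set j := (4 + k)%N in IH aj *.
have j0 : 0 < j%:R :> R by rewrite ltr0n.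
pose M := avg m0 1 (fun r => weight r ^+ j).
move=> e e0.
(* The difference of the two bounds has average j h M. *)
pose h := e / (j%:R * (`|M| + 1)).
have h0 : 0 < h by rewrite divr_gt0// mulr_gt0// ltr_wpDl.
pose u := Num.sqrt (1 + h).
have u2 : u ^+ 2 = 1 + h by rewrite sqr_sqrtr// addr_ge0// ltW.
have u0 : 0 < u by rewrite sqrtr_gt0 addr_gt0.
pose p1 r := (j%:R * h)^-1 * weight r ^+ j +
             (- ((j%:R * h)^-1 * u ^- (2 * j))) * weight (r / u) ^+ j.
have a1 : admissible p1 by apply: admissible_lin => //; exact: admissible_div aj.
have c1 : avg_cvg p1.
  apply: avg_cvg_lin => //; first exact: admissible_div aj.
  exact: avg_cvg_div u0 aj IH.
exists p1, (fun r => 1 * p1 r + (j%:R * h) * weight r ^+ j); split.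
- by split.
- by split; [exact: admissible_lin|exact: avg_cvg_lin].
- move=> r r0; pose y := weight r; pose z := (1 + h + r ^+ 2)^-1.
  have y0 : 0 < y := weight_gt0 r.
  have y1 : y <= 1 := weight_le1 r.
  have z0 : 0 < z by rewrite invr_gt0 ltr_wpDr ?sqr_ge0// addr_gt0.
  have nz1 : 1 + h != 0 by rewrite gt_eqF// addr_gt0.
  have nz2 : 1 + h + r ^+ 2 != 0 by rewrite gt_eqF// ltr_wpDr ?sqr_ge0// addr_gt0.
  have nz3 : 1 + r ^+ 2 != 0 by rewrite gt_eqF// ltr_wpDr ?sqr_ge0.
  have zE : z = u ^- 2 * weight (r / u).
    rewrite /z /weight expr_div_n u2; field.
    by rewrite nz1 nz2.
  have yz : y - z = h * y * z.
    rewrite /y /z /weight; field.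
    by rewrite nz2 nz3.
  have zy : z <= y by rewrite -subr_ge0 yz; exact: ltW (mulr_gt0 (mulr_gt0 h0 y0) z0).
  have /andP[S1 S2] := sum_ge j (ltW z0) zy.
  pose S := \sum_(i < j) y ^+ (j.-1 - i) * z ^+ i.
  rewrite -/S in S1 S2.
  have Sd : y ^+ j - z ^+ j = h * (y * z * S) by rewrite subrXX yz -/S !mulrA.
  have -> : p1 r = j%:R^-1 * (y * z * S).
    rewrite /p1 -/y.
    transitivity ((j%:R * h)^-1 * (y ^+ j - z ^+ j)).
      rewrite zE exprMn (_ : (u ^- 2) ^+ j = u ^- (2 * j)); last first.
        by rewrite exprVn -exprM.
      by ring.
    by rewrite Sd; field; rewrite !gt_eqF.
  have [i jE] : exists i, j = i.+1 by exists (3 + k)%N.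
  rewrite -/y mul1r; move: Sd S1 S2; rewrite jE/= !exprS -jE.
  have Y0 : 0 <= y ^+ i by rewrite exprn_ge0// ltW.
  have Z0 : 0 <= z ^+ i by rewrite exprn_ge0// ltW.
  have z1 : z <= 1 := le_trans zy y1.
  move: (y ^+ i) (z ^+ i) Y0 Z0 => Y Z Y0 Z0 Sd S1 S2.
  have S0 : 0 <= S by rewrite (le_trans _ S1)// mulr_ge0// ltW.
  have yz1 : y * z <= 1 by rewrite mulr_ile1// ltW.
  have yz0 : 0 < y * z by rewrite mulr_gt0.
  apply/andP; split.
    rewrite mulrC ler_pdivrMr//.
    apply: (@le_trans _ _ (y * y * (j%:R * Y))); last first.
      by rewrite le_eqVlt; apply/orP; left; apply/eqP; ring.
    by apply: ler_pM => //; [exact: ltW|rewrite ler_pM2l].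
  apply: (@le_trans _ _
    (j%:R^-1 * (y * z * (j%:R * Z)) + j%:R * h * (y * Y))); last first.
    by rewrite lerD2r ler_pM2l ?invr_gt0// ler_pM2l.
  rewrite (_ : j%:R^-1 * _ = y * (z * Z)); last by field; rewrite gt_eqF.
  rewrite -lerBlDl -mulrBr Sd (_ : j%:R * h * _ = y * (h * (j%:R * Y))); last by ring.
  rewrite ler_pM2l// ler_pM2l// (le_trans _ S2)//.
  by rewrite ler_piMl.
- rewrite avg_lin// mul1r addrC addKr -/M.
  rewrite (le_trans (ler_norm _))// normrM (gtr0_norm (mulr_gt0 j0 h0)).
  have M1 : 0 < `|M| + 1 by rewrite ltr_wpDl.
  rewrite (_ : _ * _ = e * (`|M| / (`|M| + 1))); last first.
    by rewrite /h; field; rewrite !gt_eqF.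
  by rewrite ler_piMr ?(ltW e0)// ler_pdivrMr// mul1r lerDl.
Qed.

Lemma avg_cvg_poly (Q : {poly R}) k :
  avg_cvg (fun r => weight r ^+ (4 + k) * Q.[weight r]).
Proof.
elim/poly_ind : Q k => [k|P c IH k].
  have -> : (fun r => weight r ^+ (4 + k) * (0 : {poly R}).[weight r]) =
      (fun r => 0 * weight r ^+ (4 + k) + 0 * weight r ^+ (4 + k)).
    by apply/funext => r; rewrite horner0 mulr0 !mul0r addr0.
  by apply: avg_cvg_lin; (exact: admissible_weightX || exact: avg_cvg_weightX).
have -> : (fun r => weight r ^+ (4 + k) * (P * 'X + c%:P).[weight r]) =
    (fun r => 1 * (weight r ^+ (4 + k.+1) * P.[weight r]) + c * weight r ^+ (4 + k)).
  by apply/funext => r; rewrite hornerMXaddC addnS (exprS _ (4 + k)); ring.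
apply: avg_cvg_lin => //.
- exact: admissible_poly.
- exact: admissible_weightX.
- exact: avg_cvg_weightX.
Qed.

(** The sharp step is sandwiched between two dilated smooth steps; the dilation
    factors straddle 1, which avoids the transition point [w = 1/2]. *)
Lemma avg_cvg_step : avg_cvg (\1_(`[0%R, 1%R[%classic : set R)).
Proof.
set one := \1__ : R -> R.
have oneE r : 0 <= r -> one r = (r < 1)%R%:R.
  by move=> r0; rewrite /one indicE mem_setE in_itv/= r0.
have a_one : admissible one.
  split; first exact: measurable_indic.
  exists 16 => r; rewrite /one indicE mem_setE in_itv/=.
  case: (boolP (0 <= r < 1)) => [/andP[r0 r1]|_]; last first.
    by rewrite normr0 mulr_ge0// exprn_ge0// ltW// weight_gt0.
  rewrite normr1 (_ : 16 = 2 ^+ 4); last by ring.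
  rewrite -exprMn exprn_ege1// -ler_pdivrMl// mulr1 /weight.
  rewrite lef_pV2 ?posrE ?ltr_wpDr ?sqr_ge0// lerD2l expr_le1// ltW//.
have HC16 r : 0 <= r -> r < 1 -> 1 <= 16 * weight r ^+ 4.
  move=> r0 r1; rewrite (_ : 16 = 2 ^+ 4); last by ring.
  rewrite -exprMn exprn_ege1// -ler_pdivrMl// mulr1 /weight.
  by rewrite lef_pV2 ?posrE ?ltr_wpDr ?sqr_ge0// lerD2l expr_le1// ltW.
apply: avg_cvg_sandwich => // e e0.
pose sa k r := step_approx k (weight r).
have [a_sa c_sa] : (forall k, admissible (sa k)) /\ (forall k, avg_cvg (sa k)).
  have H k : exists Q : {poly R}, sa k = (fun r => weight r ^+ (4 + 0) * Q.[weight r]).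
    have [Q QE] := @step_approx_poly R k.
    by exists Q; apply/funext => r; rewrite /sa QE.
  by split => k; have [Q ->] := H k; [exact: admissible_poly|exact: avg_cvg_poly].
pose M := avg m0 1 (fun r => weight r ^+ 4).
have M0 : 0 <= M.
  rewrite /M /avg mulr_ge0 ?invr_ge0// Rintegral_ge0// => r _.
  by rewrite exprn_ge0// ltW// weight_gt0.
have w01 r : 0 <= weight r <= 1 by rewrite (ltW (weight_gt0 r)) weight_le1.
(* A bound independent of k, to make the averages of sa k bounded. *)
have sa_le16 k r : sa k r <= 16 * weight r ^+ 4.
  have [w2|w2] := leP (2 * weight r) 1; last first.
    apply: le_trans (step_approx_le1 _ (w01 r)) _.
    rewrite (_ : 16 = 2 ^+ 4); last by ring.
    by rewrite -exprMn exprn_ege1// ltW.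
  apply: le_trans (step_approx_le _ (w01 r)) _.
  rewrite exprD (_ : 16 = 2 ^+ 4); last by ring.
  rewrite -exprMn ler_piMr ?exprn_ge0 ?exprn_ile1 ?mulr_ge0 ?(ltW (weight_gt0 r))//.
pose e1 := e / (16 * (M + 1)) / 2.
have e10 : 0 < e1 by rewrite !divr_gt0// mulr_gt0// ltr_wpDl.
(* u ^ 7 - v ^ 7 is at most 128 h when 0 < h <= 1 / 2. *)
pose h := Num.min (1 / 2) (e1 / 128).
have h0 : 0 < h by rewrite lt_min; apply/andP; split; apply: divr_gt0.
have h1 : h <= 1 / 2 by rewrite ge_min lexx.
have he : 128 * h <= e1.
  by rewrite mulrC -ler_pdivlMr// ge_min lexx orbT.
pose u := 1 + h; pose v := 1 - h.
have u0 : 0 < u by rewrite addr_gt0.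
have v0 : 0 < v by rewrite /v; lra.
have uv : u ^+ 7 - v ^+ 7 <= e1.
  apply: le_trans he; rewrite /u /v.
  have hX n : h ^+ n.+1 <= h.
    by rewrite exprS ler_piMr ?(ltW h0)// exprn_ile1 ?(ltW h0)//; lra.
  have -> : (1 + h) ^+ 7 - (1 - h) ^+ 7 =
      14 * h + 70 * h ^+ 3 + 42 * h ^+ 5 + 2 * h ^+ 7 by ring.
  have := hX 2; have := hX 4; have := hX 6; lra.
have weight_inv x : 0 < x -> 2 * weight (1 / x) = 2 * x ^+ 2 / (1 + x ^+ 2).
  move=> x0; rewrite /weight; field.
  by rewrite !gt_eqF// ltr_wpDr ?sqr_ge0.
(* A < 1 < B are the values at r = 1 of 2 w, dilated by v and by u. *)
pose A := 2 * weight (1 / v); pose B := 2 * weight (1 / u).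
have A0 : 0 < A by rewrite mulr_gt0// weight_gt0.
have A1 : A < 1.
  rewrite /A weight_inv// ltr_pdivrMr ?ltr_wpDr ?sqr_ge0// mul1r.
  have : v ^+ 2 < 1 by rewrite expr_lt1 ?(ltW v0)// /v; lra.
  lra.
have B1 : 1 < B.
  rewrite /B weight_inv// ltr_pdivlMr ?ltr_wpDr ?sqr_ge0// mul1r.
  have : 1 < u ^+ 2 by rewrite expr_gt1 ?(ltW u0)// /u; lra.
  lra.
have B0 : 0 < B := lt_trans ltr01 B1.
have [k kAB] : exists k, A ^+ k + (B ^+ (4 + k))^-1 <= e1.
  have cA : A ^+ n @[n --> \oo] --> 0 by apply: cvg_expr; rewrite gtr0_norm.
  have cB : B^-1 ^+ n @[n --> \oo] --> 0.
    apply: cvg_expr; rewrite gtr0_norm ?invr_gt0 //.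
    by rewrite invf_lt1.
  move/cvgrPdist_le : cA => /(_ (e1 / 2)) cA.
  move/cvgrPdist_le : cB => /(_ (e1 / 2)) cB.
  have e2 : 0 < e1 / 2 by rewrite divr_gt0.
  have [N _ HN] := filterI (cA e2) (cB e2).
  have [/=] := HN N (leqnn N).
  rewrite !sub0r !normrN gtr0_norm ?exprn_gt0// => AN.
  rewrite ger0_norm ?exprn_ge0 ?invr_ge0 ?(ltW B0)// => BN.
  exists N; have : (B ^+ (4 + N))^-1 <= B^-1 ^+ N.
    rewrite exprVn lef_pV2 ?posrE ?exprn_gt0 //.
    by rewrite ler_weXn2l ?leq_addl// ltW.
  lra.
have weight_anti x y : 0 <= x -> x <= y -> weight y <= weight x.
  move=> x0 xy; rewrite lef_pV2 ?posrE ?ltr_wpDr ?sqr_ge0// lerD2l.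
  by apply: lerXn2r => //; rewrite nnegrE (le_trans x0).
pose phi1 r := 1 * sa k (r / v) + (- (16 * A ^+ k)) * weight r ^+ 4.
pose phi2 r := 1 * sa k (r / u) + (16 * (B ^+ (4 + k))^-1) * weight r ^+ 4.
have aw : admissible (fun r : R => weight r ^+ 4) := @admissible_weightX R 0.
have au := admissible_div u0 (a_sa k).
have av := admissible_div v0 (a_sa k).
exists phi1, phi2; split.
- by split; [exact: admissible_lin|apply: avg_cvg_lin => //; exact: avg_cvg_div].
- by split; [exact: admissible_lin|apply: avg_cvg_lin => //; exact: avg_cvg_div].
- move=> r r0; rewrite oneE// /phi1 /phi2 !mul1r.
  have W4 : 0 <= weight r ^+ 4 by rewrite exprn_ge0// ltW// weight_gt0.
  have BV0 : 0 <= (B ^+ (4 + k))^-1 by rewrite invr_ge0 exprn_ge0// ltW.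
  have WA : 0 <= 16 * A ^+ k * weight r ^+ 4.
    by do 2 (apply: mulr_ge0 => //); apply: exprn_ge0; exact: ltW.
  have WB : 0 <= 16 * (B ^+ (4 + k))^-1 * weight r ^+ 4.
    by apply: mulr_ge0 => //; exact: mulr_ge0.
  have [r1|r1] := ltP r 1; rewrite /= ?mulr1n ?mulr0n.
    apply/andP; split.
      have := step_approx_le1 k (w01 (r / v)); rewrite -/(sa k _) mulNr; lra.
    have w16 : 1 <= 16 * weight r ^+ 4 by exact: HC16.
    have wru : weight (1 / u) <= weight (r / u).
      by apply: weight_anti; rewrite ?divr_ge0 ?(ltW u0)// ler_pM2r ?invr_gt0// ltW.
    have : 1 - ((2 * weight (r / u)) ^+ (4 + k))^-1 <= sa k (r / u).
      by apply: step_approx_ge; rewrite weight_gt0 weight_le1.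
    have : ((2 * weight (r / u)) ^+ (4 + k))^-1 <= (B ^+ (4 + k))^-1.
      rewrite lef_pV2 ?posrE ?exprn_gt0 ?mulr_gt0 ?weight_gt0//.
      by apply: lerXn2r; rewrite ?nnegrE ?mulr_ge0 ?(ltW (weight_gt0 _))// ler_pM2l.
    have : (B ^+ (4 + k))^-1 <= 16 * (B ^+ (4 + k))^-1 * weight r ^+ 4.
      by rewrite mulrAC ler_peMl.
    lra.
  apply/andP; split; last first.
    by rewrite addr_ge0// step_approx_ge0.
  have wrv : weight (r / v) <= weight (1 / v).
    by apply: weight_anti; rewrite ?divr_ge0 ?(ltW v0)// ler_pM2r ?invr_gt0.
  have wr : weight (r / v) <= weight r.
    by apply: weight_anti => //; rewrite ler_peMr// invf_ge1// /v; lra.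
  have : sa k (r / v) <= 16 * A ^+ k * weight r ^+ 4.
    apply: le_trans (step_approx_le _ (w01 _)) _.
    have -> : 16 * A ^+ k * weight r ^+ 4 = (2 * weight r) ^+ 4 * A ^+ k by ring.
    rewrite exprD; apply: ler_pM.
    - by rewrite exprn_ge0// mulr_ge0// ltW// weight_gt0.
    - by rewrite exprn_ge0// mulr_ge0// ltW// weight_gt0.
    - by apply: lerXn2r; rewrite ?nnegrE ?mulr_ge0 ?(ltW (weight_gt0 _))// ler_pM2l.
    - by apply: lerXn2r; rewrite ?nnegrE ?mulr_ge0 ?(ltW (weight_gt0 _))// ler_pM2l.
  rewrite mulNr; lra.
- rewrite !avg_lin// !avg_div// !m0_scale ?mulr1// !mul1r -/M.
  set Q := avg m0 1 (sa k).
  have QM : Q <= 16 * M.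
    have -> : 16 * M = avg m0 1 (fun r => 16 * weight r ^+ 4 + 0 * weight r ^+ 4).
      by rewrite avg_lin// mul0r addr0.
    by apply: avg_le => // [|r _]; [exact: admissible_lin|rewrite mul0r addr0].
  have Q0 : 0 <= Q.
    rewrite /Q /avg mulr_ge0 ?invr_ge0// Rintegral_ge0// => r _.
    exact: step_approx_ge0.
  have h3 : (u ^+ 7 - v ^+ 7) * Q <= e1 * (16 * M).
    apply: (@le_trans _ _ (e1 * Q)); first by rewrite ler_wpM2r.
    by rewrite ler_wpM2l// ltW.
  have h4 : 16 * M * (A ^+ k + (B ^+ (4 + k))^-1) <= 16 * M * e1.
    by rewrite ler_wpM2l// mulr_ge0.
  have h5 : 32 * M * e1 <= e.
    rewrite (_ : 32 * M * e1 = e * (M / (M + 1))); last first.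
      by rewrite /e1; field; rewrite gt_eqF// ltr_wpDl.
    by rewrite ler_piMr ?(ltW e0)// ler_pdivrMr ?ltr_wpDl// mul1r lerDl.
  lra.
Qed.
End tauberian.

(** * Borel sets and Lebesgue measure on R^7 *)

Section borel7_measurability.
Context {R : realType}.

Lemma continuous_enorm n : continuous (@enorm R n).
Proof.
move=> Y; apply: (cvg_comp (fun Y : 'rV[R]_n => \sum_(i < n) Y 0 i ^+ 2) Num.sqrt).
  apply: cvg_big => [||i _]; [exact: add_continuous|exact: nbhs_filter|].
  apply: (cvg_comp (fun Y : 'rV[R]_n => Y 0 i) (fun x => x ^+ 2)).
    exact: coord_continuous.
  exact: exprn_continuous.
exact: sqrt_continuous.
Qed.

Lemma continuous_measurable_borel7 (f : 'rV[R]_7 -> R) : continuous f ->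
  measurable_fun setT (f : borel7 R -> R).
Proof.
move=> cf; apply: (measurability _ (RGenOpens.measurableE R)).
move=> _ [_ [a [b ->] <-]]; rewrite setTI.
apply: sub_sigma_algebra; move/continuousP : cf; apply; exact: interval_open.
Qed.

Definition radius (X : 'rV[R]_7) (Y : borel7 R) : R := enorm ((Y : 'rV[R]_7) - X).

Lemma radius_ge0 X Y : 0 <= radius X Y.
Proof. exact: sqrtr_ge0. Qed.

Lemma measurable_radius X : measurable_fun setT (radius X).
Proof.
apply: continuous_measurable_borel7 => Y.
apply: (cvg_comp (fun Y : 'rV[R]_7 => Y - X) (@enorm R 7)); last first.
  exact: continuous_enorm.
apply: (@cvgB _ _ _ _ _ id (cst X)).
- exact: nbhs_filter.
- exact: cvg_id.
- by apply: cvg_cst; exact: nbhs_filter.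
Qed.

Let T7 := (R * R * R * R * R * R * R)%type.

Lemma measurable_row7_coord (i : 'I_7) :
  measurable_fun setT (fun y : T7 => row7 y 0 i).
Proof.
have e : (fun y : T7 => row7 y 0 i) =
   (nth (fun=> 0) [:: (fun y : T7 => y.1.1.1.1.1.1); (fun y => y.1.1.1.1.1.2);
    (fun y => y.1.1.1.1.2); (fun y => y.1.1.1.2); (fun y => y.1.1.2);
    (fun y => y.1.2); (fun y => y.2)] i).
  apply/funext => -[[[[[[y1 y2] y3] y4] y5] y6] y7].
  rewrite /row7 mxE; case: i => -[|[|[|[|[|[|[|]]]]]]]//.
have m6 : measurable_fun setT (fun y : T7 => y.1) by exact: measurable_fst.
have m5 := measurableT_comp measurable_fst m6.
have m4 := measurableT_comp measurable_fst m5.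
have m3 := measurableT_comp measurable_fst m4.
have m2 := measurableT_comp measurable_fst m3.
rewrite e; case: i {e} => -[|[|[|[|[|[|[|]]]]]]]//= _.
- exact: (measurableT_comp measurable_fst m2).
- exact: (measurableT_comp measurable_snd m2).
- exact: (measurableT_comp measurable_snd m3).
- exact: (measurableT_comp measurable_snd m4).
- exact: (measurableT_comp measurable_snd m5).
- exact: (measurableT_comp measurable_snd m6).
- exact: measurable_snd.
Qed.

(** An open set is the countable union of the rational boxes that it contains,
    and boxes pull back to measurable sets of the product. *)
Lemma measurable_row7 : measurable_fun (setT : set T7) (@row7 R : T7 -> borel7 R).
Proof.
apply: (measurability (@open 'rV[R]_7 : set (set (borel7 R)))) => //.
move=> _ [U oU <-]; rewrite setTI.
pose box (q : 'rV[rat]_7) (k : nat) : set 'rV[R]_7 :=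
  [set Z | forall i, `|ratr (q 0 i) - Z 0 i| < k.+1%:R^-1].
pose F (qk : 'rV[rat]_7 * nat) : set T7 :=
  if `[< box qk.1 qk.2 `<=` U >] then @row7 R @^-1` box qk.1 qk.2 else set0.
have -> : @row7 R @^-1` U = \bigcup_qk F qk.
  apply/seteqP; split => [y /= Uy|y [qk _]]; last first.
    by rewrite /F; case: asboolP => // bU /bU.
  have /nbhs_ballP[e /= e0 eU] := open_nbhs_nbhs (conj oU Uy).
  have [k ke] : exists k : nat, k.+1%:R^-1 < e / 2.
    exists (Num.truncn (e / 2)^-1).
    by rewrite -[ltRHS]invrK ltf_pV2 ?posrE ?invr_gt0 ?divr_gt0// truncnS_gt.
  have Hq (i : 'I_7) : exists q : rat, `|ratr q - row7 y 0 i| < k.+1%:R^-1.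
    have : row7 y 0 i - k.+1%:R^-1 < row7 y 0 i + k.+1%:R^-1.
      by rewrite ltrBlDr -addrA ltrDl addr_gt0.
    move=> /rat_in_itvoo[r]; rewrite in_itv/= => /andP[r1 r2].
    by exists r; rewrite ltr_distl; apply/andP; split.
  pose q := \row_i projT1 (cid (Hq i)).
  have qb : box q k (row7 y).
    by move=> i; rewrite mxE; case: cid.
  exists (q, k) => //; rewrite /F/=; case: asboolP => // -[] Z bZ.
  apply: eU; split => // i j; rewrite ord1 /ball/=.
  apply: le_lt_trans (ler_distD (ratr (q 0 j)) _ _) _.
  rewrite [ltRHS]splitr ltrD//; last exact: lt_trans (bZ j) ke.
  by rewrite distrC; exact: lt_trans (qb j) ke.
apply: countable_bigcupT_measurable; first exact: countableP.
move=> [q k]; rewrite /F/=; case: asboolP => // _.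
have -> : @row7 R @^-1` box q k =
    \bigcap_(i in [set: 'I_7]) ((fun y => row7 y 0 i) @^-1`
      (ball (ratr (q 0 i) : R) k.+1%:R^-1 : set R)).
  by apply/seteqP; split => y /= h i; [move=> _|]; apply: h.
apply: fin_bigcap_measurable => // i _.
rewrite -[X in measurable X]setTI; apply: measurable_row7_coord => //.
exact: measurable_ball.
Qed.

End borel7_measurability.

Section lebesgue7_theory.
Context {R : realType}.
Local Open Scope ereal_scope.
Local Notation leb := (@lebesgue_measure R).

Definition scales_measure d (T : measurableType d) (m : set T -> \bar R) (f : T -> T)
  (c : R) := forall A, measurable A -> m (f @^-1` A) = c%:E * m A.

Lemma scales_lebesgue (s : R) : (0 < s)%R ->
  scales_measure (leb : set (measurableTypeR R) -> \bar R) (fun x => s * x)%R s^-1.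
Proof.
move=> s0 A mA.
have ms : measurable_fun setT
    ((fun x => s * x)%R : measurableTypeR R -> measurableTypeR R).
  exact: measurable_funM.
pose pm : {measure set (measurableTypeR R) -> \bar R} :=
  measure_function_pushforward__canonical__measure_function_Measure leb ms.
have s0' : (0 <= s)%R by exact: ltW.
pose m' : {measure set (measurableTypeR R) -> \bar R} := mscale (NngNum s0') pm.
have -> : leb ((fun x => s * x)%R @^-1` A) = pm A by [].
have -> : leb A = m' A.
  apply: lebesgue_measure_unique => // _ [[a b]] /= _ <-.
  rewrite /m' /= /mscale/= /pushforward.
  have -> : (fun x => s * x)%R @^-1` `]a, b] = `](a / s)%R, (b / s)%R]%classic.
    apply/seteqP; split => x /=; rewrite !in_itv/=;
    by rewrite ltr_pdivrMr// ler_pdivlMr// (mulrC x).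
  rewrite !lebesgue_measure_itv/= !lte_fin ltr_pM2r ?invr_gt0//.
  case: ifPn => ab; last by rewrite mule0.
  rewrite -!EFinB -EFinM; congr (_%:E); field; rewrite gt_eqF//.
rewrite /m' /= /mscale/= muleA -EFinM mulVf ?mul1e// gt_eqF//.
Qed.

Lemma scales_prod d1 d2 (T1 : measurableType d1) (T2 : measurableType d2)
  (m1 : {measure set T1 -> \bar R}) (m2 : {sigma_finite_measure set T2 -> \bar R})
  (f1 : T1 -> T1) (f2 : T2 -> T2) (c1 c2 : R) :
  measurable_fun setT f1 -> measurable_fun setT f2 ->
  (0 <= c1)%R -> (0 <= c2)%R ->
  scales_measure m1 f1 c1 -> scales_measure m2 f2 c2 ->
  scales_measure (m1 \x m2) (fun z => (f1 z.1, f2 z.2)) (c1 * c2).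
Proof.
move=> mf1 mf2 c10 c20 s1 s2 A mA.
have mg : measurable_fun setT (m2 \o xsection A) by exact: measurable_fun_xsection.
rewrite /product_measure1.
transitivity (\int[m1]_x (c2%:E * (m2 \o xsection A) (f1 x))).
  apply: eq_integral => x _ /=; rewrite -s2; last exact: measurable_xsection.
  by congr (m2 _); apply/seteqP; split => y; rewrite /xsection/= !inE.
rewrite ge0_integralZl ?lee_fin//; last exact: measurableT_comp.
rewrite EFinM -muleA muleCA; congr (_ * _).
have -> : \int[m1]_x (m2 \o xsection A) (f1 x) =
   \int[pushforward m1 f1]_x (m2 \o xsection A) x.
  by rewrite ge0_integral_pushforward.
rewrite -(@ge0_integral_mscale _ _ _ m1 setT measurableT (NngNum c10))//.
apply: eq_measure_integral => B mB _; exact: s1.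
Qed.

Lemma measurable_map_pair d1 d2 (T1 : measurableType d1) (T2 : measurableType d2)
  (f1 : T1 -> T1) (f2 : T2 -> T2) :
  measurable_fun setT f1 -> measurable_fun setT f2 ->
  measurable_fun setT (fun z => (f1 z.1, f2 z.2)).
Proof.
move=> m1 m2; apply: measurable_fun_pair.
  exact: (measurableT_comp m1 measurable_fst).
exact: (measurableT_comp m2 measurable_snd).
Qed.

(** Each of the seven factors scales by [s^-1]; products of scaling maps are handled
    by [scales_prod]. *)
Lemma lebesgue7_scale (s : R) : (0 < s)%R ->
  scales_measure (@lebesgue7 R)
    (fun Y : borel7 R => s *: (Y : 'rV[R]_7) : borel7 R) (s ^- 7).
Proof.
move=> s0 A mA.
have s0' : (0 <= s^-1)%R by rewrite invr_ge0 ltW.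
pose g1 : measurableTypeR R -> measurableTypeR R := (fun x => s * x)%R.
have mg1 : measurable_fun setT g1 by exact: measurable_funM.
have sg1 := scales_lebesgue s0.
have mg2 := measurable_map_pair mg1 mg1.
have sg2 := scales_prod mg1 mg1 s0' s0' sg1 sg1.
have s2 : (0 <= s^-1 * s^-1)%R by rewrite mulr_ge0.
have mg3 := measurable_map_pair mg2 mg1.
have sg3 := scales_prod mg2 mg1 s2 s0' sg2 sg1.
have s3 : (0 <= s^-1 * s^-1 * s^-1)%R by rewrite mulr_ge0.
have mg4 := measurable_map_pair mg3 mg1.
have sg4 := scales_prod mg3 mg1 s3 s0' sg3 sg1.
have s4 : (0 <= s^-1 * s^-1 * s^-1 * s^-1)%R by rewrite mulr_ge0.
have mg5 := measurable_map_pair mg4 mg1.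
have sg5 := scales_prod mg4 mg1 s4 s0' sg4 sg1.
have s5 : (0 <= s^-1 * s^-1 * s^-1 * s^-1 * s^-1)%R by rewrite mulr_ge0.
have mg6 := measurable_map_pair mg5 mg1.
have sg6 := scales_prod mg5 mg1 s5 s0' sg5 sg1.
have s6 : (0 <= s^-1 * s^-1 * s^-1 * s^-1 * s^-1 * s^-1)%R by rewrite mulr_ge0.
have sg7 := scales_prod mg6 mg1 s6 s0' sg6 sg1.
have mrA : measurable (@row7 R @^-1` A).
  rewrite -[X in measurable X]setTI; exact: measurable_row7.
have := sg7 _ mrA.
rewrite /lebesgue7 /pushforward /g1 => H.
transitivity ((s^-1 * s^-1 * s^-1 * s^-1 * s^-1 * s^-1 * s^-1)%:E *
  (leb \x leb \x leb \x leb \x leb \x leb \x leb) (@row7 R @^-1` A)); last first.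
  by congr (_%:E * _); field; rewrite gt_eqF.
rewrite -H; congr ((_ \x _) _).
apply/seteqP; split => -[[[[[[y1 y2] y3] y4] y5] y6] y7] /=;
  (set Z1 := (X in A X); set Z2 := (X in _ -> A X); suff -> : Z1 = Z2 by [];
  apply/rowP => i; rewrite /Z1 /Z2 !mxE;
  by case: i => -[|[|[|[|[|[|[|]]]]]]]).
Qed.

Lemma enormZ n (a : R) (Y : 'rV[R]_n) : enorm (a *: Y) = (`|a| * enorm Y)%R.
Proof.
rewrite /enorm -sqrtr_sqr -sqrtrM ?sqr_ge0//; congr Num.sqrt.
by rewrite mulr_sumr; apply: eq_bigr => i _; rewrite mxE exprMn.
Qed.

Lemma enormN n (Y : 'rV[R]_n) : enorm (- Y) = enorm Y.
Proof. by rewrite -scaleN1r enormZ normrN1 mul1r. Qed.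

Lemma measurable_eball X (r : R) : measurable (eball X r : set (borel7 R)).
Proof.
have -> : eball X r = radius X @^-1` `]-oo, r[%classic.
  by apply/seteqP; split => Y; rewrite /eball/= in_itv.
by rewrite -[X in measurable X]setTI; exact: measurable_radius.
Qed.

Lemma lebesgue7_eball (r : R) : (0 < r)%R ->
  @lebesgue7 R (eball 0%R r) = (r ^+ 7)%:E * @lebesgue7 R (eball 0%R 1%R).
Proof.
move=> r0; have ri : (0 < r^-1)%R by rewrite invr_gt0.
have := lebesgue7_scale ri (measurable_eball 0%R 1%R).
rewrite exprVn invrK => <-; congr (lebesgue7 _).
apply/seteqP; split => Y; rewrite /eball/= !subr0 enormZ gtr0_norm//;
  by rewrite ltr_pdivrMl// mulr1.
Qed.


End lebesgue7_theory.

Section lebesgue7_ball.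
Context {R : realType}.
Local Open Scope ereal_scope.
Local Notation leb := (@lebesgue_measure R).

Definition box7 (I : 'I_7 -> set R) : set (borel7 R) :=
  [set Y | forall i, I i ((Y : 'rV[R]_7) 0%R i)].

Let cube (I : set R) := box7 (fun=> I).

Let lebesgue7_cube (I : set R) : measurable I ->
  @lebesgue7 R (cube I) = leb I * leb I * leb I * leb I * leb I * leb I * leb I.
Proof.
move=> mI; rewrite /lebesgue7 /pushforward.
have -> : @row7 R @^-1` cube I =
  I `*` I `*` I `*` I `*` I `*` I `*` I.
  apply/seteqP; split => -[[[[[[y1 y2] y3] y4] y5] y6] y7] /=.
    move=> H; have h (i : nat) (i7 : (i < 7)%N) := H (Ordinal i7).
    have := (h 0%N isT, h 1%N isT, h 2%N isT, h 3%N isT, h 4%N isT, h 5%N isT, h 6%N isT).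
    by rewrite !mxE/=; do ?case.
  move=> [[[[[[h1 h2] h3] h4] h5] h6] h7] i; rewrite mxE.
  by case: i => -[|[|[|[|[|[|[|]]]]]]].
have mX d (T : measurableType d) (B : set T) : measurable B ->
    measurable (B `*` (I : set (measurableTypeR R))) by move=> mB; exact: measurableX.
have m1 : measurable (I : set (measurableTypeR R)) by [].
have m2 := mX _ _ _ m1; have m3 := mX _ _ _ m2; have m4 := mX _ _ _ m3.
have m5 := mX _ _ _ m4; have m6 := mX _ _ _ m5.
rewrite (product_measure1E _ _ m6 m1)/=.
rewrite (product_measure1E _ _ m5 m1)/=.
rewrite (product_measure1E _ _ m4 m1)/=.
rewrite (product_measure1E _ _ m3 m1)/=.
rewrite (product_measure1E _ _ m2 m1)/=.
by rewrite (product_measure1E _ _ m1 m1).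
Qed.


Definition lebesgue7_measure : {measure set (borel7 R) -> \bar R} :=
  measure_function_pushforward__canonical__measure_function_Measure
   (leb \x leb \x leb \x leb \x leb \x leb \x leb) measurable_row7.

Lemma lebesgue7_measureE :
  lebesgue7_measure = @lebesgue7 R :> (set (borel7 R) -> \bar R).
Proof. by []. Qed.

Lemma measurable_box7 (I : 'I_7 -> set R) :
  (forall i, measurable (I i)) -> measurable (box7 I).
Proof.
move=> mI; have -> : box7 I = \bigcap_(i in [set: 'I_7])
    ((fun Y : borel7 R => (Y : 'rV[R]_7) 0%R i) @^-1` I i).
  by apply/seteqP; split => Y /= h i; [move=> _|]; apply: h.
apply: fin_bigcap_measurable => // i _.
rewrite -[X in measurable X]setTI.
apply: continuous_measurable_borel7 => //; exact: coord_continuous.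
Qed.

Let measurable_cube (I : set R) : measurable I -> measurable (cube I).
Proof. by move=> mI; apply: measurable_box7. Qed.

Lemma ler_coord_enorm n (Y : 'rV[R]_n) i : (`|Y 0%R i| <= enorm Y)%R.
Proof.
rewrite -sqrtr_sqr ler_wsqrtr// (bigD1 i)//=.
by rewrite lerDl sumr_ge0// => j _; rewrite sqr_ge0.
Qed.

Lemma lebesgue7_ball_lty : @lebesgue7 R (eball 0%R 1%R) < +oo.
Proof.
rewrite -lebesgue7_measureE.
apply: (@le_lt_trans _ _ (lebesgue7_measure (cube `[(-1)%R, 1%R]))).
  apply: le_measure; rewrite ?inE; [exact: measurable_eball|exact: measurable_cube|].
  move=> Y; rewrite /eball/= subr0 => Y1 i.
  suff : (Y : 'rV[R]_7) 0%R i \in `[(-1)%R, 1%R] by [].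
  rewrite in_itv/= -ler_norml.
  exact: le_trans (ler_coord_enorm _ _) (ltW Y1).
rewrite lebesgue7_measureE lebesgue7_cube// lebesgue_measure_itv/= lte_fin.
rewrite ifT; last by lra.
by rewrite -EFinB -!EFinM ltry.
Qed.

Lemma lebesgue7_ball_gt0 : 0 < @lebesgue7 R (eball 0%R 1%R).
Proof.
rewrite -lebesgue7_measureE.
apply: (@lt_le_trans _ _ (lebesgue7_measure (cube `[0%R, (1 / 3)%R[))).
  rewrite lebesgue7_measureE lebesgue7_cube// lebesgue_measure_itv/= lte_fin.
  rewrite ifT; last by lra.
  by rewrite -EFinB -!EFinM lte_fin !mulr_gt0//; lra.
apply: le_measure; rewrite ?inE; [exact: measurable_cube|exact: measurable_eball|].
move=> Y YI; rewrite /eball/= subr0 /enorm.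
rewrite -[ltRHS]sqrtr1 ltr_sqrt//.
apply: (@le_lt_trans _ _ (\sum_(i < 7) (1 / 9))%R); last first.
  by rewrite sumr_const card_ord -mulr_natl; lra.
apply: ler_sum => i _; have : (Y : 'rV[R]_7) 0%R i \in `[0%R, (1 / 3)%R[ := YI i.
rewrite in_itv/= => /andP[y0 y1].
rewrite (_ : 1 / 9 = (1 / 3) ^+ 2)%R; last by field.
by apply: lerXn2r; [rewrite nnegrE|rewrite nnegrE; lra|exact: ltW].
Qed.

End lebesgue7_ball.

(** * The radial distribution of a measure on R^7 *)

Section radial.
Context {R : realType}.
Implicit Types (mu : {measure set (borel7 R) -> \bar R}) (X : 'rV[R]_7).

Definition radial mu X : {measure set R -> \bar R} :=
  measure_function_pushforward__canonical__measure_function_Measure mu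
    (measurable_radius X).

Lemma radialE mu X (s : R) : radial mu X `]-oo, s[%classic = mu (eball X s).
Proof.
by rewrite /radial /= /pushforward; congr (mu _).
Qed.

Lemma mass_radial mu X (s : R) : mass (radial mu X) s = mu (eball X s).
Proof.
rewrite /mass /radial /= /pushforward; congr (mu _).
by apply/seteqP; split => Y; rewrite /= in_itv/= radius_ge0.
Qed.

Lemma ge0_integral_radial mu X (g : R -> \bar R) : measurable_fun setT g ->
  (forall r, 0 <= g r)%E ->
  (\int[radial mu X]_(r in `[0%R, +oo[) g r = \int[mu]_Y g (radius X Y))%E.
Proof.
move=> mg g0; rewrite ge0_integral_pushforward//=;
  [|exact: measurable_radius|exact: measurable_funTS].
rewrite (_ : _ @^-1` _ = setT)//; apply/seteqP; split => Y //= _.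
by rewrite in_itv/= radius_ge0.
Qed.

(** A ball lies in a compact box. *)
Lemma radon_ball_lty mu X (s : R) : radon mu -> (mu (eball X s) < +oo)%E.
Proof.
move=> rmu; pose K := box7 (fun i => `[X 0 i - `|s|, X 0 i + `|s|]%classic).
have cK : compact (K : set 'rV[R]_7).
  by apply: (@rV_compact R 7) => i; exact: segment_compact.
apply: le_lt_trans (rmu _ cK); apply: le_measure; rewrite ?inE.
- exact: measurable_eball.
- by apply: measurable_box7.
move=> Y Ys i.
suff : (Y : 'rV[R]_7) 0 i \in `[X 0 i - `|s|, X 0 i + `|s|] by [].
rewrite in_itv/= -ler_distl.
have := ler_coord_enorm ((Y : 'rV[R]_7) - X) i; rewrite !mxE => /le_trans; apply.
exact: ltW (lt_le_trans Ys (ler_norm _)).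
Qed.

End radial.
(* Simplification would expose the pushforward of a sevenfold product. *)
#[local] Arguments radial : simpl never.
#[local] Arguments lebesgue7_measure : simpl never.

Section mass_theory.
Context {R : realType} (m : {measure set R -> \bar R}).

Lemma mass_ge0 (s : R) : (0 <= mass m s)%E.
Proof. exact: measure_ge0. Qed.

Lemma mass_nd (s t : R) : s <= t -> (mass m s <= mass m t)%E.
Proof.
move=> st; apply: le_measure; rewrite ?inE//.
by move=> r /=; rewrite !in_itv/= => /andP[-> /lt_le_trans]; apply.
Qed.

Hypothesis mfin : forall s : R, (m `]-oo, s[%classic < +oo)%E.

Lemma mass_fin_num (s : R) : mass m s \is a fin_num.
Proof.
rewrite ge0_fin_numE; last exact: mass_ge0.
apply: le_lt_trans (mfin s); apply: le_measure; rewrite ?inE//.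
by move=> r /=; rewrite !in_itv/= => /andP[].
Qed.

Lemma measurable_mass : measurable_fun setT (mass m).
Proof.
have -> : mass m = EFin \o (fine \o mass m).
  by apply/funext => s /=; rewrite fineK// mass_fin_num.
apply/measurable_EFinP; apply: nondecreasing_measurable => // s t st /=.
by rewrite fine_le ?mass_fin_num ?mass_nd.
Qed.

End mass_theory.

(** * The potential of a radial distribution, and the model *)

Section potential.
Context {R : realType}.
Local Notation D := (`[0%R, +oo[%classic : set R).

Definition potential (m : {measure set R -> \bar R}) (x : R) : \bar R :=
  (\int[m]_(r in D) ((x ^+ 2 + r ^+ 2) ^- 4)%:E)%E.

Lemma measurable_potential_kernel (x : R) : 0 < x ->
  measurable_fun setT (fun r : R => (x ^+ 2 + r ^+ 2) ^- 4).
Proof.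
move=> x0; apply: continuous_measurable_fun => r.
apply: cvgV; first by rewrite expf_neq0 ?gt_eqF ?sqrD_gt0.
apply: (cvg_comp (fun t => x ^+ 2 + t ^+ 2) (fun u => u ^+ 4)).
  by apply: cvgD; [exact: cvg_cst|exact: exprn_continuous].
exact: exprn_continuous.
Qed.

Lemma potential_ge0 (m : {measure set R -> \bar R}) x : (0 <= potential m x)%E.
Proof.
by apply: integral_ge0 => r _; rewrite lee_fin invr_ge0 exprn_ge0// addr_ge0 ?sqr_ge0.
Qed.

Section power.
Variables (m : {measure set R -> \bar R}) (om : R).
Hypothesis mfin : forall s : R, (m `]-oo, s[%classic < +oo)%E.
Hypotheses (om0 : 0 < om)
  (mE : forall s, 0 < s -> mass m s = (s ^+ 7 * om)%:E).

(** The layer kernel at [x = 1] times [s^7] is at most [8 / (1 + s^2)]. *)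
Lemma potential_power_lty : (potential m 1 < +oo)%E.
Proof.
rewrite /potential (layer_cake mfin)//.
apply: (@le_lt_trans _ _ (\int[lebesgue_measure]_(s in D)
   ((8 * om)%:E * ((oneDsqr s)^-1)%:E))%E).
  apply: ge0_le_integral => //=.
  - move=> s; rewrite in_itv/= andbT => s0; rewrite mule_ge0//.
    by rewrite lee_fin layer_kernel_ge0.
  - exact: (@measurable_layer_kernelM _ (mass m) 1 D ltr01 (measurable_mass mfin)).
  - by apply: measurable_funeM; apply: measurable_funTS; apply/measurable_EFinP;
      apply: continuous_measurable_fun; exact: continuous_oneDsqrV.
  - move=> s; rewrite in_itv/= andbT le_eqVlt => /predU1P[<-|s0].
      rewrite /layer_kernel mulr0 mul0r mul0e.
      by rewrite mule_ge0// lee_fin ?invr_ge0 ?mulr_ge0 ?(ltW om0).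
    rewrite mE// -!EFinM lee_fin /layer_kernel /oneDsqr expr1n.
    have q0 : 0 < 1 + s ^+ 2 by rewrite ltr_wpDr ?sqr_ge0.
    have -> : 8 * s / (1 + s ^+ 2) ^+ 5 * (s ^+ 7 * om) =
        8 * om * (s ^+ 8 / (1 + s ^+ 2) ^+ 5) by field; rewrite gt_eqF.
    rewrite ler_pM2l ?mulr_gt0 ?om0// ler_pdivrMr ?exprn_gt0//.
    have -> : (1 + s ^+ 2)^-1 * (1 + s ^+ 2) ^+ 5 = (1 + s ^+ 2) ^+ 4.
      by field; rewrite gt_eqF.
    have -> : s ^+ 8 = (s ^+ 2) ^+ 4 by ring.
    by apply: lerXn2r; rewrite ?nnegrE ?sqr_ge0 ?(ltW q0)// lerDr.
rewrite ge0_integralZl//; last 2 first.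
- by apply: measurable_funTS; apply/measurable_EFinP;
    apply: continuous_measurable_fun; exact: continuous_oneDsqrV.
- by rewrite lee_fin mulr_ge0// ltW.
by rewrite integral0y_oneDsqr -EFinM ltry.
Qed.

Lemma potential_power_gt0 : (0 < potential m 1)%E.
Proof.
apply: (@lt_le_trans _ _ (\int[m]_(r in `[0%R, 1%R[) (2 ^- 4)%:E)%E).
  rewrite integral_cst// mule_gt0 ?lte_fin ?invr_gt0 ?exprn_gt0//.
  by rewrite -/(mass m 1) mE// lte_fin mulr_gt0 ?om0.
apply: (@le_trans _ _ (\int[m]_(r in `[0%R, 1%R[) ((1 ^+ 2 + r ^+ 2) ^- 4)%:E)%E).
  apply: ge0_le_integral => //.
  - apply: measurable_funTS; apply/measurable_EFinP.
    exact: measurable_potential_kernel ltr01.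
  - move=> r /=; rewrite in_itv/= => /andP[r0 r1]; rewrite lee_fin expr1n.
    have q0 : 0 < 1 + r ^+ 2 by rewrite ltr_wpDr ?sqr_ge0.
    rewrite lef_pV2 ?posrE ?exprn_gt0//.
    have : 1 + r ^+ 2 <= 2 by have := exprn_ile1 2 r0 (ltW r1); lra.
    by move=> q2; apply: lerXn2r => //; rewrite nnegrE ltW.
apply: ge0_subset_integral => //.
- apply: measurable_funTS; apply/measurable_EFinP.
    exact: measurable_potential_kernel ltr01.
- by move=> r _; rewrite lee_fin invr_ge0 exprn_ge0// addr_ge0 ?sqr_ge0.
- by move=> r /=; rewrite !in_itv/= => /andP[->].
Qed.

End power.
End potential.

Section lebesgue_model.
Context {R : realType}.
Local Notation m0 := (@radial R lebesgue7_measure 0).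
Local Notation D := (`[0%R, +oo[%classic : set R).

Lemma omega7_gt0 : 0 < omega7 R.
Proof. by rewrite /omega7 fine_gt0// lebesgue7_ball_gt0 lebesgue7_ball_lty. Qed.

Lemma mass_model (s : R) : 0 < s -> mass m0 s = (s ^+ 7 * omega7 R)%:E.
Proof.
move=> s0; rewrite mass_radial lebesgue7_measureE lebesgue7_eball// [RHS]EFinM /omega7 fineK//.
by rewrite ge0_fin_numE ?lebesgue7_ball_lty ?(ltW lebesgue7_ball_gt0).
Qed.

(** The dilation by [x^-1] of [R^7] multiplies distances by [x^-1] and Lebesgue
    measure by [x^7]. *)
Lemma ge0_integral_model_scale (x : R) (g : R -> \bar R) : 0 < x ->
  measurable_fun setT g -> (forall r, 0 <= g r)%E ->
  (\int[m0]_(r in D) g (r / x)%R = (x ^+ 7)%:E * \int[m0]_(r in D) g r)%E.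
Proof.
move=> x0 mg g0; have xV0 : 0 < x^-1 by rewrite invr_gt0.
have x7 : 0 <= x ^+ 7 by rewrite exprn_ge0// ltW.
rewrite !ge0_integral_radial//; last first.
  by apply: (measurableT_comp mg); exact: measurable_funM.
pose S (Y : borel7 R) : borel7 R := x^-1 *: (Y : 'rV[R]_7).
have mgd : measurable_fun setT (g \o radius 0).
  by apply: (measurableT_comp mg); exact: measurable_radius.
have mS : measurable_fun setT S.
  apply: (@measurability _ _ _ _ _ _ (@open 'rV[R]_7 : set (set (borel7 R)))) => //.
  move=> _ [U oU <-]; rewrite setTI; apply: sub_sigma_algebra.
  have : continuous (fun Y : 'rV[R]_7 => x^-1 *: Y) by exact: scaler_continuous.
  by move/continuousP; apply.
rewrite -(@ge0_integral_mscale _ _ _ lebesgue7_measure setT measurableT (NngNum x7))//.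
transitivity (\int[lebesgue7_measure]_Y (g \o radius 0) (S Y))%E.
  apply: eq_integral => Y _ /=; congr g.
  by rewrite /radius !subr0 /S enormZ gtr0_norm// mulrC.
rewrite -(@ge0_integral_pushforward _ _ _ _ _ _ mS lebesgue7_measure setT (g \o radius 0))//.
apply: eq_measure_integral => A mA _.
rewrite /pushforward/= /mscale/=.
have := lebesgue7_scale xV0 mA; rewrite exprVn invrK => h; exact: h.
by move=> Y _; exact: g0.
Qed.

Lemma radial_mfin (mu : {measure set (borel7 R) -> \bar R}) (X : 'rV[R]_7) :
  radon mu -> forall s : R, (radial mu X `]-oo, s[%classic < +oo)%E.
Proof. by move=> rmu s; rewrite radialE; exact: radon_ball_lty. Qed.

Lemma model_mfin (s : R) : (m0 `]-oo, s[%classic < +oo)%E.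
Proof.
rewrite radialE lebesgue7_measureE.
apply: (@le_lt_trans _ _ (lebesgue7 (eball (0 : 'rV[R]_7) (`|s| + 1)))).
  apply: (@le_measure _ _ _ (@lebesgue7_measure R)); rewrite ?inE; [exact: measurable_eball..|].
  by move=> Y /lt_le_trans; apply; rewrite (le_trans (ler_norm s))// lerDl.
rewrite lebesgue7_eball ?ltr_wpDl// lte_mul_pinfty ?lee_fin ?exprn_ge0 ?addr_ge0//.
exact: lebesgue7_ball_lty.
Qed.

Lemma potential_radial (mu : {measure set (borel7 R) -> \bar R}) (X : 'rV[R]_7) x :
  0 < x -> (\int[mu]_Y (poisson_shape x (X - (Y : 'rV[R]_7)))%:E =
            x%:E * potential (radial mu X) x)%E.
Proof.
move=> x0; rewrite /potential -ge0_integralZl//; last 3 first.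
- apply: measurable_funTS; apply/measurable_EFinP.
    exact: measurable_potential_kernel.
- by move=> r _; rewrite lee_fin invr_ge0 exprn_ge0// addr_ge0 ?sqr_ge0.
- by rewrite lee_fin ltW.
rewrite (@ge0_integral_radial _ _ _ (fun r => x%:E * ((x ^+ 2 + r ^+ 2) ^- 4)%:E)%E).
- apply: eq_integral => Y _; rewrite -EFinM /poisson_shape /radius.
  by rewrite -opprB enormN.
- by apply: measurable_funeM; apply/measurable_EFinP; exact: measurable_potential_kernel.
- move=> r; rewrite mule_ge0 ?lee_fin ?(ltW x0)//.
  by rewrite invr_ge0 exprn_ge0// addr_ge0 ?sqr_ge0.
Qed.

Lemma potential_model_scale x : 0 < x -> (x%:E * potential m0 x = potential m0 1)%E.
Proof.
move=> x0.
have := @ge0_integral_model_scale x (fun r => ((1 ^+ 2 + r ^+ 2) ^- 4)%:E) x0 _ _.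
have -> : (\int[m0]_(r in D) ((1 ^+ 2 + (r / x) ^+ 2) ^- 4)%:E =
   (x ^+ 8)%:E * potential m0 x)%E.
  rewrite /potential -ge0_integralZl//; last 3 first.
  - apply: measurable_funTS; apply/measurable_EFinP.
    exact: measurable_potential_kernel.
  - by move=> r _; rewrite lee_fin invr_ge0 exprn_ge0// addr_ge0 ?sqr_ge0.
  - by rewrite lee_fin exprn_ge0// ltW.
  apply: eq_integral => r _; rewrite -EFinM; congr (_%:E); field.
  by rewrite !gt_eqF ?sqrD_gt0.
move=> /(_ _ _)/wrap[||].
- by apply/measurable_EFinP; exact: measurable_potential_kernel ltr01.
- by move=> r; rewrite lee_fin invr_ge0 exprn_ge0// addr_ge0 ?sqr_ge0.
rewrite -/(potential m0 1) => H.
have : ((x ^- 7)%:E * ((x ^+ 8)%:E * potential m0 x) =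
    (x ^- 7)%:E * ((x ^+ 7)%:E * potential m0 1))%E.
  by rewrite H.
rewrite !muleA -!EFinM mulVf ?mul1e; last by rewrite expf_neq0// gt_eqF.
by move=> <-; congr (_%:E * _)%E; field; rewrite gt_eqF.
Qed.

Lemma potential_model_lty : (potential m0 1 < +oo)%E.
Proof. exact: potential_power_lty model_mfin omega7_gt0 mass_model. Qed.

Lemma potential_model_gt0 : (0 < potential m0 1)%E.
Proof. exact: potential_power_gt0 omega7_gt0 mass_model. Qed.

End lebesgue_model.


Section averages_of_potential.
Context {R : realType} (m : {measure set R -> \bar R}).
Local Notation D := (`[0%R, +oo[%classic : set R).

Lemma weight4_integrable : (potential m 1 < +oo)%E ->
  m.-integrable D (EFin \o (fun r => weight r ^+ 4)).
Proof.
move=> m1; have mw : measurable_fun setT (fun r : R => weight r ^+ 4).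
  by have [] := @admissible_weightX R 0.
apply/integrableP; split.
  by apply/measurable_EFinP; exact: measurable_funTS.
apply: le_lt_trans m1; rewrite le_eqVlt; apply/orP; left; apply/eqP.
apply: eq_integral => r _ /=; rewrite ger0_norm ?exprn_ge0 ?(ltW (weight_gt0 r))//.
by rewrite /weight exprVn expr1n.
Qed.

Lemma avg_weight4 (x : R) : 0 < x -> (potential m x < +oo)%E ->
  (avg m x (fun r => weight r ^+ 4))%:E = (x%:E * potential m x)%E.
Proof.
move=> x0 mx; rewrite /avg /Rintegral.
have -> : (\int[m]_(r in D) (weight (r / x) ^+ 4)%:E = (x ^+ 8)%:E * potential m x)%E.
  rewrite /potential -ge0_integralZl//; last 3 first.
  - apply: measurable_funTS; apply/measurable_EFinP.
    exact: measurable_potential_kernel.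
  - by move=> r _; rewrite lee_fin invr_ge0 exprn_ge0// addr_ge0 ?sqr_ge0.
  - by rewrite lee_fin exprn_ge0// ltW.
  apply: eq_integral => r _; rewrite -EFinM /weight; congr (_%:E); field.
  by rewrite !gt_eqF ?sqrD_gt0.
have mf : potential m x \is a fin_num by rewrite ge0_fin_numE// potential_ge0.
rewrite fineM// mulrA !EFinM fineK//=; congr (_ * _)%E; rewrite -EFinM.
by congr (_%:E); field; rewrite gt_eqF.
Qed.

Lemma avg_step (x : R) : 0 < x ->
  avg m x (\1_(`[0%R, 1%R[%classic : set R)) = x ^- 7 * fine (mass m x).
Proof.
move=> x0; rewrite /avg /Rintegral; congr (_ * fine _).
transitivity (\int[m]_(r in D) (\1_(`[0%R, x[%classic : set R) r)%:E)%E.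
  apply: eq_integral => r; rewrite inE/= in_itv/= andbT => r0.
  rewrite !indicE !mem_setE !in_itv/= r0 divr_ge0 ?(ltW x0)//=.
  by rewrite ltr_pdivrMr// mul1r.
rewrite integral_indic//; congr (m _); apply/setIidPl.
by move=> r /=; rewrite !in_itv/= andbT => /andP[].
Qed.

End averages_of_potential.

Section homogeneous_average.
Context {R : realType} (m : {measure set R -> \bar R}).
Local Notation D := (`[0%R, +oo[%classic : set R).
Hypothesis m1 : (potential m 1 < +oo)%E.
Hypothesis m_scale : forall (x : R) (g : R -> \bar R), 0 < x ->
  measurable_fun setT g -> (forall r, 0 <= g r)%E ->
  (\int[m]_(r in D) g (r / x)%R = (x ^+ 7)%:E * \int[m]_(r in D) g r)%E.

Let mw := weight4_integrable m1.

(** Homogeneity is known for nonnegative integrands; an admissible [phi] is the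
    difference of [phi + C weight^4] and [C weight^4]. *)
Lemma avg_homogeneous (x : R) (phi : R -> R) : 0 < x -> admissible phi ->
  avg m x phi = avg m 1 phi.
Proof.
have nn y (psi : R -> R) : 0 < y -> admissible psi -> (forall r, 0 <= psi r) ->
    avg m y psi = fine (\int[m]_(r in D) (psi r)%:E)%E.
  move=> y0 ap p0; rewrite /avg /Rintegral.
  have mp : measurable_fun setT psi by case: ap.
  rewrite (@m_scale y (fun r => (psi r)%:E))//; last first.
    exact/measurable_EFinP.
  have fi : (\int[m]_(r in D) (psi r)%:E)%E \is a fin_num.
    have mD : measurable D by [].
    exact (integrable_fin_num mD (admissible_integrable mw ap)).
  by rewrite fineM// mulrA mulVf ?mul1r// expf_neq0// gt_eqF.
move=> x0 ap; have [mp [C HC]] := ap.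
have aw : admissible (fun r : R => weight r ^+ 4) := @admissible_weightX R 0.
have a1 : admissible (fun r => 1 * phi r + C * weight r ^+ 4) by exact: admissible_lin.
have e : phi = (fun r => 1 * (1 * phi r + C * weight r ^+ 4) + (- C) * weight r ^+ 4).
  by apply/funext => r; ring.
have w0 (r : R) : 0 <= weight r ^+ 4 by rewrite exprn_ge0// ltW// weight_gt0.
have p0 (r : R) : 0 <= 1 * phi r + C * weight r ^+ 4.
  rewrite mul1r addrC -[X in _ + X]opprK subr_ge0 (le_trans _ (HC r))//.
  by rewrite -normrN ler_norm.
rewrite e (avg_lin mw _ _ x0 a1 aw) (avg_lin mw _ _ ltr01 a1 aw).
by rewrite (nn x _ x0 a1 p0) (nn 1 _ ltr01 a1 p0) (nn x _ x0 aw w0) (nn 1 _ ltr01 aw w0).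
Qed.

End homogeneous_average.

Lemma cvg_EFin_iff {R : realType} (f : R -> R) (r : R) (F : set_system R) :
  Filter F -> (f x)%:E @[x --> F] --> r%:E <-> f x @[x --> F] --> r.
Proof.
move=> FF; split=> [/fine_cvgP[]//|h].
by apply: cvg_EFin => //; exact: nearW.
Qed.

(** * Limits along the vertical line above X *)

Section vertical_limit.
Context {R : realType} (mu : {measure set (borel7 R) -> \bar R}) (X : 'rV[R]_7).
Variables (u : R -> R) (c : R).
Hypotheses (rmu : radon mu) (c0 : 0 <= c).
Hypothesis uE : forall x, 0 < x -> ((u x)%:E = (c * x)%:E +
  \int[mu]_(Y in setT) (poisson x (X - (Y : 'rV[R]_7)))%:E)%E.
Local Notation m := (radial mu X).
Local Notation m0 := (@radial R lebesgue7_measure 0).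
Local Notation K := (fine (potential m0 1)).

Let K0 : 0 < K.
Proof. by rewrite fine_gt0// potential_model_gt0 potential_model_lty. Qed.

Let KE : (K%:E = potential m0 1)%E.
Proof. by rewrite fineK// ge0_fin_numE ?potential_model_lty// potential_ge0. Qed.

Lemma poisson_constant :
  fine (\int[@lebesgue7 R]_(Z in setT) (poisson_shape 1 Z)%:E)%E = K.
Proof.
congr fine; rewrite -[RHS]mul1e -potential_radial//.
apply: eq_integral => Z _; congr (_%:E); rewrite /poisson_shape sub0r.
by rewrite enormN.
Qed.

Lemma u_potential x : 0 < x ->
  ((u x)%:E = (c * x)%:E + (K^-1)%:E * (x%:E * potential m x))%E.
Proof.
move=> x0; rewrite uE//; congr (_ + _)%E.
rewrite -potential_radial// -ge0_integralZl//; last 3 first.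
- apply/measurable_EFinP.
  rewrite (_ : (fun Y => _) =
      (fun Y => x * (fun r => (x ^+ 2 + r ^+ 2) ^- 4) (radius X Y))); last first.
    apply/funext => Y; rewrite /poisson_shape /radius.
    by rewrite -opprB enormN.
  apply: measurable_funM => //.
  by apply: (measurableT_comp (measurable_potential_kernel x0)); exact: measurable_radius.
- by move=> Y _; rewrite lee_fin divr_ge0 ?exprn_ge0 ?addr_ge0 ?sqr_ge0// ltW.
- by rewrite lee_fin invr_ge0 ltW.
by apply: eq_integral => Y _; rewrite /poisson poisson_constant mulrC EFinM.
Qed.

(** The value [u x] is a real number, so the potential cannot be infinite. *)
Lemma potential_fin_num x : 0 < x -> potential m x \is a fin_num.
Proof.
move=> x0; rewrite ge0_fin_numE ?potential_ge0// ltNge leye_eq; apply/negP => /eqP py.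
have := u_potential x0; rewrite py mulry gtr0_sg// mul1e mulry gtr0_sg ?invr_gt0//.
by rewrite mul1e addey.
Qed.

Definition scaled_potential x := fine (x%:E * potential m x)%E.

Lemma scaled_potentialE x : 0 < x -> (x%:E * potential m x = (scaled_potential x)%:E)%E.
Proof. by move=> x0; rewrite fineK// fin_numM ?potential_fin_num. Qed.

Lemma u_scaled_potential x : 0 < x -> u x = c * x + K^-1 * scaled_potential x.
Proof.
move=> x0; apply: EFin_inj.
by rewrite u_potential// scaled_potentialE// EFinD (EFinM K^-1).
Qed.

Let mfin := @radial_mfin R mu X rmu.

Let layer_scaled_potential x : 0 < x ->
  (x%:E * layer_int (mass m) x = (scaled_potential x)%:E)%E.
Proof.
by move=> x0; rewrite -scaled_potentialE// /potential (layer_cake mfin).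
Qed.

Let massE : mass m = fun s => ball_mass mu s X.
Proof. by apply/funext => s; rewrite mass_radial. Qed.

Let cx_cvg : c * x @[x --> 0^'+] --> (0 : R).
Proof.
rewrite -[X in _ --> X](mulr0 c); apply: cvgM; first exact: cvg_cst.
exact: cvg_at_right_filter cvg_id.
Qed.

Lemma vertical_limit_infinite (a : R) : 0 < a ->
  (u x)%:E @[x --> 0^'+] --> +oo%E <-> infinite_density mu X a.
Proof.
move=> a0.
have H := infinite_limit_density_int (measurable_mass mfin) (mass_ge0 m)
  layer_scaled_potential
  (@mass_nd _ m) a0.
rewrite /density_int massE in H; rewrite /infinite_density -H {H}.
split=> /cvgeyPge U; apply/cvgeyPge => A; near=> x; rewrite lee_fin.
- have x0 : 0 < x by [].
  have : ((K^-1 * A + c)%:E <= (u x)%:E)%E by near: x; exact: U.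
  rewrite lee_fin u_scaled_potential// => h.
  have x1 : x <= 1 by near: x; exact: nbhs_right_le.
  have : c * x <= c by rewrite ler_piMr.
  move=> h2; rewrite -(@ler_pM2l _ K^-1) ?invr_gt0//; lra.
- have x0 : 0 < x by [].
  have : ((K * A)%:E <= (scaled_potential x)%:E)%E by near: x; exact: U.
  rewrite lee_fin u_scaled_potential// => h.
  have : 0 <= c * x by rewrite mulr_ge0// ltW.
  have : A <= K^-1 * scaled_potential x by rewrite ler_pdivlMl.
  lra.
Unshelve. all: by end_near. Qed.

Let u_cvg_scaled_potential (r : R) : u x @[x --> 0^'+] --> r <->
  scaled_potential x @[x --> 0^'+] --> r * K.
Proof.
have Kn : K != 0 by rewrite gt_eqF.
split=> H.
- have -> : r * K = K * (r - 0) by rewrite subr0 mulrC.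
  have h : K * (u x - c * x) @[x --> 0^'+] --> K * (r - 0).
    by apply: cvgM; [exact: cvg_cst|exact: cvgB H cx_cvg].
  apply: cvg_trans h; apply: near_eq_cvg; near=> x.
  by rewrite u_scaled_potential// addrC addKr mulVKf.
- have -> : r = 0 + K^-1 * (r * K) by rewrite add0r mulrCA mulVf ?mulr1.
  have h : c * x + K^-1 * scaled_potential x @[x --> 0^'+] --> 0 + K^-1 * (r * K).
    by apply: cvgD => //; apply: cvgM => //; exact: cvg_cst.
  by apply: cvg_trans h; apply: near_eq_cvg; near=> x; rewrite u_scaled_potential.
Unshelve. all: by end_near. Qed.

Let finite_densityE (r : R) : finite_density mu X r%:E <->
  t ^- 7 * fine (mass m t) @[t --> 0^'+] --> r * omega7 R.
Proof.
rewrite /finite_density -EFinM mulrC.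
have e : (fun t : R => (t ^- 7)%:E * ball_mass mu t X)%E =
   EFin \o (fun t => t ^- 7 * fine (mass m t)).
  apply/funext => t; transitivity ((t ^- 7)%:E * mass m t)%E.
    by rewrite massE.
  by rewrite -{1}(fineK (mass_fin_num mfin t)) -EFinM.
by rewrite e; exact: cvg_EFin_iff.
Qed.

Lemma vertical_limit_finite (r : R) : 0 <= r ->
  u x @[x --> 0^'+] --> r <-> finite_density mu X r%:E.
Proof.
move=> r0; rewrite u_cvg_scaled_potential finite_densityE.
have om0 := @omega7_gt0 R.
split=> H.
- have mw : m.-integrable (`[0%R, +oo[%classic : set R)
      (EFin \o (fun r => weight r ^+ 4)).
    by apply: weight4_integrable; rewrite ltey_eq potential_fin_num.
  have m0w := weight4_integrable (@potential_model_lty R).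
  have c4 : avg_cvg m m0 r (fun r => weight r ^+ 4).
    rewrite /avg_cvg; have -> : avg m0 1 (fun r => weight r ^+ 4) = K.
      apply: EFin_inj; rewrite avg_weight4 ?potential_model_lty// mul1e.
      by rewrite KE.
    apply: cvg_trans H; apply: near_eq_cvg; near=> x.
    have x0 : 0 < x by [].
    apply: EFin_inj; rewrite -scaled_potentialE// avg_weight4//.
    by rewrite ltey_eq potential_fin_num.
  have avg0 := avg_homogeneous (@potential_model_lty R) (@ge0_integral_model_scale R).
  have := avg_cvg_step mw m0w avg0 r0 c4.
  rewrite /avg_cvg avg_step// expr1n invr1 mul1r mass_model// expr1n mul1r /=.
  apply: cvg_trans; apply: near_eq_cvg; near=> t.
  by rewrite avg_step.
- apply: (abelian_comparison (measurable_mass mfin) (mass_ge0 m) layer_scaled_potential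
    (measurable_mass (@model_mfin R)) (mass_ge0 m0) r0).
    move=> x x0; have -> : layer_int (mass m0) x = potential m0 x.
      by rewrite /potential (layer_cake (@model_mfin R)).
    by rewrite potential_model_scale// KE.
  move=> e e0.
  have e1 : 0 < e * omega7 R by rewrite mulr_gt0.
  move/cvgrPdist_le : H => /(_ _ e1) H.
  near=> s.
  have s0 : 0 < s by [].
  have : `|r * omega7 R - s ^- 7 * fine (mass m s)| <= e * omega7 R by near: s.
  rewrite ler_norml => /andP[h1 h2].
  have s7 : 0 < s ^+ 7 by rewrite exprn_gt0.
  rewrite mass_model// -(fineK (mass_fin_num mfin s)) -!EFinM -!EFinD !lee_fin.
  set N := fine _ in h1 h2 *.
  set q := s ^- 7 * N in h1 h2.
  have -> : N = s ^+ 7 * q by rewrite mulVKf// gt_eqF.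
  clearbody q; split; first by rewrite mulrCA ler_pM2l//; lra.
  by rewrite !(mulrCA _ (s ^+ 7)) -mulrDr ler_pM2l//; lra.
Unshelve. all: by end_near. Qed.

End vertical_limit.

Unset Implicit Arguments.
Set Strict Implicit.

Theorem theorem2 (R : realType) (f : 'rV[R]_8 -> 'rV[R]_8)
  (mu : 'I_8 -> {measure set (borel7 R) -> \bar R})
  (l : 'I_8 -> \bar R) (X : 'rV[R]_7)
  (f_monogenic : monogenic half_space f)
  (f_ge0 : forall (j : 'I_8) (x : 'rV[R]_8), half_space x -> 0 <= component f j x)
  (mu_boundary : forall j : 'I_8, boundary_measure (component f j) (mu j))
  (l_ge0 : forall j : 'I_8, (0 <= l j)%E) :
  (forall (j : 'I_8) (a b : R), 0 < a -> 0 < b ->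
     infinite_density (mu j) X a -> infinite_density (mu j) X b) /\
  ((forall j : 'I_8,
      (fun x0 : R => (component f j (hpoint x0 X))%:E) @ (0 : R)^'+ --> l j) <->
   (forall j : 'I_8,
      (l j \is a fin_num -> finite_density (mu j) X (l j)) /\
      (l j = +oo%E ->
         exists2 a : R, 0 < a & infinite_density (mu j) X a))).
Proof.
have inf j a : 0 < a ->
    (fun x0 : R => (component f j (hpoint x0 X))%:E) @ (0 : R)^'+ --> +oo%E <->
    infinite_density (mu j) X a.
  move=> a0; have [rmu [c c0 uE]] := mu_boundary j.
  apply: (vertical_limit_infinite rmu c0 _ a0) => x x0; exact: uE.
have fin j r : 0 <= r ->
    (fun x0 : R => (component f j (hpoint x0 X))%:E) @ (0 : R)^'+ --> r%:E <->
    finite_density (mu j) X r%:E.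
  move=> r0; have [rmu [c c0 uE]] := mu_boundary j.
  rewrite -(@vertical_limit_finite _ _ _ (fun x => component f j (hpoint x X)) c)//.
    exact: cvg_EFin_iff.
  by move=> x x0; exact: uE.
split=> [j a b a0 b0|]; first by rewrite -!inf.
split=> H j; [split|].
- move=> lfin; have lE := fineK lfin.
  by rewrite -lE -fin ?fine_ge0// lE.
- by move=> ly; exists 1 => //; rewrite -inf// -ly.
- have [Hfin Hinf] := H j.
  have := l_ge0 j; case: (l j) Hfin Hinf => [r| |]// Hfin Hinf r0.
    by apply/fin => //; exact: Hfin.
  by have [a a0 /inf] := Hinf erefl; apply.
Qed.
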